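(* Let $D\subseteq\mathbb{R}^2$ be a convex Jordan domain. Then $$\mathrm{area}(D)\ge\frac{\mathrm{SC}(D)^2}{\sqrt{3}},$$ where equality is achieved if $D$ is an equilateral triangle. Hence the equilateral triangle has the maximal sweeping cost over all planar convex Jordan domains of the same area.
   Context: A Jordan domain $D\subseteq\mathbb{R}^2$ is a homeomorphic image of a closed disk in $\mathbb{R}^2$, with boundary $\partial D$. $L(\gamma)$ denotes the length of a continuous path $\gamma$; $\gamma$ is rectifiable if $L(\gamma)<\infty$. $\mathrm{area}$ denotes planar Lebesgue measure. Let $I=[0,1]$. A sensor curve in $D$ is a continuous map $f\colon I\times I\to D$ such that (i) each curve $f(\cdot,t)\colon I\to D$ is rectifiable and injective for $t\in(0,1)$; (ii) $f(I,0)$ and $f(I,1)$ are each (possibly distinct) single points in $\partial D$; (iii) $f(s,t)\in\partial D$ implies $s\in\{0,1\}$ or $t\in\{0,1\}$. Standing assumption: attention is restricted to sensor curves for which the converse of (iii) holds as well, i.e. $f(s,t)\in\partial D$ if and only if $s\in\{0,1\}$ or $t\in\{0,1\}$. The length of a sensor curve is $L(f)=\max_{t\in I}L(f(\cdot,t))$. A sensor curve $f$ is a sweep of $D$ if for every continuous path $\gamma\colon I\to D$ there is some $t\in I$ with $\gamma(t)\in f(I,t)$. Let $\mathcal{F}(D)$ be the set of all sensor curves that are sweeps of $D$. The sweeping cost of $D$ is $\mathrm{SC}(D)=\inf_{f\in\mathcal{F}(D)}L(f)$. *)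

(* Defs.v *)
From HB Require Import structures.
From mathcomp Require Import all_boot all_order all_algebra.
From mathcomp Require Import all_classical all_reals all_analysis.

Set Implicit Arguments.
Unset Strict Implicit.
Unset Printing Implicit Defensive.

Import Order.TTheory GRing.Theory Num.Theory.
Import numFieldNormedType.Exports.

Local Open Scope classical_set_scope.
Local Open Scope ring_scope.

(* The canonical norm of the product R * R is the sup norm: it induces the
   usual topology, but distances and lengths must be taken with edist. *)
Definition edist {R : realType} (x y : R * R) : R :=
  Num.sqrt ((x.1 - y.1) ^+ 2 + (x.2 - y.2) ^+ 2).

Definition area {R : realType} : set (R * R) -> \bar R :=
  ((@lebesgue_measure R) \x (@lebesgue_measure R))%E.

Definition boundary {T : topologicalType} (A : set T) : set T :=
  closure A `\` interior A.

Definition homeomorphic {T U : topologicalType} (A : set T) (B : set U) : Prop :=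
  exists (f : T -> U) (g : U -> T),
    [/\ {within A, continuous f}, {within B, continuous g},
        f @` A `<=` B, g @` B `<=` A &
        (forall x, A x -> g (f x) = x) /\ (forall y, B y -> f (g y) = y)].

Definition jordan_domain {R : realType} (D : set (R * R)) : Prop :=
  homeomorphic [set x : R * R | edist x 0 <= 1] D.

Definition convex_jordan_domain {R : realType} (D : set (R * R)) : Prop :=
  jordan_domain D /\ @convex_set R (R * R)%type D.

(* The same sum as the library's variation, for plane-valued g. *)
Definition polygonal_length {R : realType} (g : R -> R * R) (s : seq R) : R :=
  let G := g \o nth 1 (0 :: s) in
  \sum_(0 <= n < size s) edist (G n.+1) (G n).

Definition path_length {R : realType} (g : R -> R * R) : \bar R :=
  ereal_sup [set (polygonal_length g s)%:E | s in itv_partition 0 1].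

Definition rectifiable {R : realType} (g : R -> R * R) : Prop :=
  (path_length g < +oo)%E.

(* The values of f outside the unit square are irrelevant. *)
Record sensor_curve {R : realType} (D : set (R * R)) (f : R * R -> R * R) : Prop := {
  sensor_continuous : {within `[0, 1] `*` `[0, 1], continuous f} ;
  sensor_in : forall s t, s \in `[0, 1] -> t \in `[0, 1] -> D (f (s, t)) ;
  sensor_rectifiable : forall t, t \in `]0, 1[ ->
    rectifiable (fun s => f (s, t)) ;
  sensor_injective : forall t, t \in `]0, 1[ ->
    {in `[0, 1] &, injective (fun s => f (s, t))} ;
  sensor_start : exists2 p, boundary D p & forall s, s \in `[0, 1] -> f (s, 0) = p ;
  sensor_end : exists2 p, boundary D p & forall s, s \in `[0, 1] -> f (s, 1) = p ;
  sensor_boundary : forall s t, s \in `[0, 1] -> t \in `[0, 1] ->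
    boundary D (f (s, t)) <-> [\/ s = 0, s = 1, t = 0 | t = 1]
}.

(* A supremum in \bar R: the maximum whenever it is attained. *)
Definition sensor_length {R : realType} (f : R * R -> R * R) : \bar R :=
  ereal_sup [set path_length (fun s => f (s, t)) | t in `[0, 1]].

Definition is_sweep {R : realType} (D : set (R * R)) (f : R * R -> R * R) : Prop :=
  sensor_curve D f /\
  forall gamma : R -> R * R, {within `[0, 1], continuous gamma} ->
    (forall t, t \in `[0, 1] -> D (gamma t)) ->
    exists2 t, t \in `[0, 1] & exists2 s, s \in `[0, 1] & gamma t = f (s, t).

Definition sweeping_cost {R : realType} (D : set (R * R)) : \bar R :=
  ereal_inf [set sensor_length f | f in is_sweep D].

Definition triangle {R : realType} (a b c : R * R) : set (R * R) :=
  [set x | exists u v w : R, [/\ 0 <= u, 0 <= v, 0 <= w, u + v + w = 1 &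
             x = u *: a + v *: b + w *: c]].

Definition equilateral_triangle {R : realType} (T : set (R * R)) : Prop :=
  exists a b c : R * R, [/\ 0 < edist a b, edist a b = edist b c,
    edist b c = edist c a & T = triangle a b c].

(* Main.v *)
(* A convex domain contained in a strip of width [w] is swept at cost [w]: the chords
   orthogonal to the strip have length at most [w], and after an arbitrarily small tilt
   the first and the last chord are single points.  So the sweeping cost [w] bounds every
   width of [D] from below, and it remains to see that then [w^2 / sqrt 3 <= area D].
   Take an inscribed triangle of maximal area [S], with sides [l, m, n].  Let [al] be the
   largest distance of a point of [D] beyond the first side, measured in units of the
   height on that side, and [be], [ga] likewise.  By maximality [al, be, ga] are at most
   [1], the width orthogonal to the first side is [2 S (1 + al) / l], and [D] contains four
   disjoint triangles of total area [S s], where [s = 1 + al + be + ga].  Summing the three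
   widths, [w (l + m + n) <= 2 S (s + 2)]; with the isoperimetric inequality
   [(l + m + n)^2 >= 12 sqrt 3 S] this gives [S s >= 3 sqrt 3 w^2 s / (s + 2)^2], and
   [9 s >= (s + 2)^2] because [1 <= s <= 4].

   In an equilateral triangle of height [h], if the two ends [x], [y] of the sensor curve
   were always at distance less than [h], some product [x_i y_i] of their barycentric
   coordinates would be positive at all times, and an evader on the boundary could escape
   by moving to the point with barycentric coordinates proportional to
   [max_j x_j y_j - x_i y_i]. *)

Require Import Defs.
From HB Require Import structures.
From mathcomp Require Import all_boot all_order all_algebra.
From mathcomp Require Import all_classical all_reals all_analysis.
From mathcomp Require Import measurable_realfun.
From mathcomp Require Import ring lra.
(* Imported again: the library has another [edist]. *)
Require Import Defs.

Set Implicit Arguments.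
Unset Strict Implicit.
Unset Printing Implicit Defensive.

Import Order.TTheory GRing.Theory Num.Theory.
Import numFieldNormedType.Exports.

Local Open Scope classical_set_scope.
Local Open Scope ring_scope.

(** * Plane area under affine maps *)

Section affine_measure.
Context {R : realType}.
Local Notation mu := (@lebesgue_measure R).

Lemma measurable_affine (k c : R) :
  measurable_fun (setT : set R) (fun y : R => k * y + c).
Proof.
apply: measurable_funD; last exact: measurable_cst.
exact: measurable_funM (measurable_cst _) (@measurable_id _ _ _).
Qed.

(** The pushforward of [mu] under the affine map, scaled by [|k|], gives every half-open interval
    its length, hence equals [mu] by uniqueness of Lebesgue measure. *)
Lemma lebesgue_measure_affine (k c : R) (A : set R) : k != 0 -> measurable A ->
  mu ((fun y => k * y + c) @^-1` A) = (`|k|^-1%:E * mu A)%E.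
Proof.
move=> k0 mA.
pose f : measurableTypeR R -> measurableTypeR R := fun y => k * y + c.
have mf : measurable_fun setT f := measurable_affine k c.
have nk : 0 <= `|k| by [].
have [pm pmE] : exists pm : {measure set (measurableTypeR R) -> \bar R},
  forall X, mscale (NngNum nk) pm X = (`|k|%:E * mu (f @^-1` X))%E.
  by exists (measure_function_pushforward__canonical__measure_function_Measure mu mf).
suff E : (mu A = `|k|%:E * mu (f @^-1` A))%E.
  by rewrite E muleA -EFinM mulVf ?normr_eq0// mul1e.
rewrite -pmE; refine (@lebesgue_measure_unique R (mscale (NngNum nk) pm) _ A mA).
move=> _ [[a b] _ <-].
transitivity (`|k|%:E * mu (f @^-1` [set` `]a, b]]))%E; last first.
  exact/esym/(pmE [set` `]a, b]]).
have [k_gt0|k_lt0|/eqP] := ltgtP k 0; last by rewrite (negPf k0).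
- have -> : f @^-1` [set` `]a, b]] = `[(b - c) / k, (a - c) / k[%classic.
    apply/seteqP; split=> y /=; rewrite !in_itv/= /f.
    + by rewrite ler_ndivrMr// ltr_ndivlMr// => /andP[? ?]; apply/andP; split; lra.
    + by rewrite ler_ndivrMr// ltr_ndivlMr// => /andP[? ?]; apply/andP; split; lra.
  rewrite !lebesgue_measure_itv/= !lte_fin ltr_nM2r ?invr_lt0// ltrD2r.
  case: ifP => _; last by rewrite mule0.
  by rewrite -!EFinB -EFinM ltr0_norm//; congr EFin; field.
- have -> : f @^-1` [set` `]a, b]] = `](a - c) / k, (b - c) / k]%classic.
    apply/seteqP; split=> y /=; rewrite !in_itv/= /f.
    + by rewrite ltr_pdivrMr// ler_pdivlMr// => /andP[? ?]; apply/andP; split; lra.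
    + by rewrite ltr_pdivrMr// ler_pdivlMr// => /andP[? ?]; apply/andP; split; lra.
  rewrite !lebesgue_measure_itv/= !lte_fin ltr_pM2r ?invr_gt0// ltrD2r.
  case: ifP => _; last by rewrite mule0.
  by rewrite -!EFinB -EFinM gtr0_norm//; congr EFin; field.
Qed.

(** Area integrates the lengths of the vertical sections, and over each abscissa the map is affine
    with slope [k]. *)
Lemma area_shear (k : R) (g : R -> R) (A : set (measurableTypeR R * measurableTypeR R)) :
  k != 0 -> measurable A ->
  area [set p | A (p.1, k * p.2 + g p.1)] = (`|k|^-1%:E * area A)%E.
Proof.
move=> k0 mA; rewrite /area /product_measure1.
rewrite -ge0_integralZl//=; last exact: measurable_fun_xsection.
apply: eq_integral => x _ /=.
rewrite -(@lebesgue_measure_affine k (g x))//; last exact: measurable_xsection.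
Qed.

(** The pushforward under the swap has the right value on rectangles, and a product measure is
    determined by these values. *)
Lemma area_swap (A : set (measurableTypeR R * measurableTypeR R)) : measurable A ->
  area [set p | A (p.2, p.1)] = area A.
Proof.
move=> mA; pose T := measurableTypeR R.
have [pm pmE] : exists pm : {measure set (T * T) -> \bar R},
    forall X, pm X = area [set p | X (p.2, p.1)].
  by exists (measure_function_pushforward__canonical__measure_function_Measure
    (mu \x mu)%E (@measurable_swap _ _ T T)).
rewrite -pmE; symmetry; refine (@product_measure_unique _ _ T T R mu mu pm _ A mA).
move=> B C mB mC; transitivity (area (C `*` B)); last first.
  by rewrite /area product_measure1E// muleC.
by rewrite pmE; congr area; apply/seteqP; split=> -[x y] [].
Qed.

End affine_measure.

Section plane_measure.
Context {R : realType}.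
Local Notation mu := (@lebesgue_measure R).
Local Notation T := (measurableTypeR R).

Lemma measurable_affine2 (a b c : R) :
  measurable_fun (setT : set (T * T)) (fun p : T * T => a * p.1 + b * p.2 + c : T).
Proof.
apply: measurable_funD; last exact: measurable_cst.
by apply: measurable_funD; apply: measurable_funM => //; exact: measurable_cst.
Qed.

Lemma measurable_halfplane (a b c : R) :
  measurable ([set p : R * R | 0 <= a * p.1 + b * p.2 + c] : set (T * T)).
Proof.
have := @measurable_affine2 a b c measurableT `[0, +oo[%classic (measurable_itv _).
rewrite setTI; congr measurable.
by apply/seteqP; split => p /=; rewrite in_itv/= andbT.
Qed.

Lemma measurable_open_halfplane (a b c : R) :
  measurable ([set p : R * R | 0 < a * p.1 + b * p.2 + c] : set (T * T)).
Proof.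
have := @measurable_affine2 a b c measurableT `]0, +oo[%classic (measurable_itv _).
rewrite setTI; congr measurable.
by apply/seteqP; split => p /=; rewrite in_itv/= andbT.
Qed.

Lemma measurable_affine_preimage (a b c a' b' c' : R) (A : set (T * T)) :
  measurable A ->
  measurable ([set p : R * R | A (a * p.1 + b * p.2 + c, a' * p.1 + b' * p.2 + c')] : set (T * T)).
Proof.
move=> mA; have := measurable_fun_pair (measurable_affine2 a b c)
  (measurable_affine2 a' b' c') measurableT mA.
by rewrite setTI.
Qed.

(** An affine map whose last coefficient is nonzero is a vertical shear followed by a horizontal
    one; the latter is a vertical shear conjugated by the swap. The two factors multiply to the
    determinant. *)
Lemma area_affine_preimage (a b c a' b' c' : R) (A : set (T * T)) :
  a * b' - a' * b != 0 -> measurable A ->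
  area [set p : R * R | A (a * p.1 + b * p.2 + c, a' * p.1 + b' * p.2 + c')] =
  (`|a * b' - a' * b|^-1%:E * area A)%E.
Proof.
have main (a0 b0 c0 a1 b1 c1 : R) (B : set (T * T)) : b1 != 0 ->
    a0 * b1 - a1 * b0 != 0 -> measurable B ->
    area [set p : R * R | B (a0 * p.1 + b0 * p.2 + c0, a1 * p.1 + b1 * p.2 + c1)] =
    (`|a0 * b1 - a1 * b0|^-1%:E * area B)%E.
  move=> b10 d0 mB; set k := (a0 * b1 - a1 * b0) / b1.
  have k0 : k != 0 by rewrite mulf_neq0// invr_eq0.
  pose d := c0 - b0 / b1 * c1.
  pose U := [set q : R * R | B (k * q.1 + (b0 / b1) * q.2 + d, 0 * q.1 + 1 * q.2 + 0)].
  have mU : measurable (U : set (T * T)) by exact: measurable_affine_preimage.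
  have -> : [set p | B (a0 * p.1 + b0 * p.2 + c0, a1 * p.1 + b1 * p.2 + c1)] =
            [set p | U (p.1, b1 * p.2 + (a1 * p.1 + c1))].
    have E (x y : R) : a0 * x + b0 * y + c0 =
        k * x + b0 / b1 * (b1 * y + (a1 * x + c1)) + d.
      rewrite /k /d. field; exact: b10.
    have E1 (x y : R) : a1 * x + b1 * y + c1 = b1 * y + (a1 * x + c1) by ring.
    by apply/funext => p; rewrite /U /= E E1 mul0r add0r mul1r addr0.
  rewrite (area_shear (fun x => a1 * x + c1) b10 mU) -(area_swap mU).
  pose V := [set q : R * R | B (q.2, q.1)].
  have mV : measurable (V : set (T * T)).
    have -> : V = [set p : R * R | B (0 * p.1 + 1 * p.2 + 0, 1 * p.1 + 0 * p.2 + 0)].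
      by apply/funext => p; rewrite /V /= !mul0r !mul1r !add0r !addr0.
    exact: measurable_affine_preimage.
  have -> : [set p | U (p.2, p.1)] = [set p | V (p.1, k * p.2 + (b0 / b1 * p.1 + d))].
    by apply/funext => p; rewrite /U /V /= mul0r mul1r add0r addr0 -addrA.
  rewrite (area_shear (fun x => b0 / b1 * x + d) k0 mV) (area_swap mB).
  rewrite muleA -EFinM; congr (_%:E * _)%E.
  by rewrite -invfM -normrM /k; congr (`|_|^-1); field; exact: b10.
(* If [b'] vanishes, the determinant forces [a'] to be nonzero, and swapping the variables leads
   back to the main case. *)
have [->|b'0] := eqVneq b' 0; last exact: main.
rewrite mulr0 sub0r oppr_eq0 mulf_eq0 negb_or => /andP[a'0 b0] mA.
rewrite -area_swap; last exact: measurable_affine_preimage.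
transitivity (area [set p : R * R | A (b * p.1 + a * p.2 + c, 0 * p.1 + a' * p.2 + c')]).
  by congr area; apply/funext => p /=; rewrite [a * _ + _]addrC [a' * _ + _]addrC.
rewrite main//; last by rewrite mul0r subr0 mulf_neq0.
by rewrite mul0r subr0 normrN mulrC.
Qed.

End plane_measure.

(** * Barycentric coordinates and the area of a triangle *)

Section triangle_area.
Context {R : realType}.
Local Notation mu := (@lebesgue_measure R).
Local Notation T := (measurableTypeR R).
Implicit Types a b c p : R * R.

(** Twice the signed area of the triangle; positive for counterclockwise vertices. *)
Definition det3 a b c : R :=
  (b.1 - a.1) * (c.2 - a.2) - (b.2 - a.2) * (c.1 - a.1).

Lemma det3_rot a b c : det3 b c a = det3 a b c.
Proof. by rewrite /det3; ring. Qed.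

(** The barycentric coordinate of [p] at the vertex [a], as a ratio of signed areas. The coordinates
    at [b] and [c] come from rotating the arguments. *)
Definition bary a b c p : R := det3 p b c / det3 a b c.

Lemma bary_sum a b c p : det3 a b c != 0 ->
  bary a b c p + bary b c a p + bary c a b p = 1.
Proof.
move=> d0; rewrite /bary (det3_rot b c a) (det3_rot a b c).
by rewrite -!mulrDl; apply: (canLR (mulfK d0)); rewrite mul1r /det3; ring.
Qed.

Lemma baryE a b c (u v w : R) : det3 a b c != 0 -> u + v + w = 1 ->
  bary a b c (u *: a + v *: b + w *: c) = u.
Proof.
move=> d0 s1; apply: (canLR (mulfK d0)); rewrite /det3 /= /GRing.scale/=.
have -> : u = 1 - v - w by rewrite -s1; ring.
ring.
Qed.

Lemma bary_comb a b c p : det3 a b c != 0 ->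
  p = bary a b c p *: a + bary b c a p *: b + bary c a b p *: c.
Proof.
move=> d0; rewrite /bary (det3_rot b c a) (det3_rot a b c).
case: p a b c d0 => [p1 p2] [a1 a2] [b1 b2] [c1 c2]; rewrite /det3/= => d0.
by congr pair; rewrite /= /GRing.scale/=; field.
Qed.

Lemma bary_affine a b c : exists x y z : R, forall p, bary a b c p = x * p.1 + y * p.2 + z.
Proof.
exists ((b.2 - c.2) / det3 a b c), ((c.1 - b.1) / det3 a b c),
  ((b.1 * c.2 - b.2 * c.1) / det3 a b c).
move=> p; rewrite /bary !(mulrAC _ _^-1) -!mulrDl; congr (_ / _); rewrite /det3; ring.
Qed.

(** The triangle without its side [b c]. Dropping one side lets adjacent triangles be disjoint, so
    that areas add exactly. *)
Definition half_triangle a b c : set (R * R) :=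
  [set p | [/\ 0 < bary a b c p, 0 <= bary b c a p & 0 <= bary c a b p]].

Lemma triangleE a b c : det3 a b c != 0 -> triangle a b c =
  [set p | [/\ 0 <= bary a b c p, 0 <= bary b c a p & 0 <= bary c a b p]].
Proof.
move=> d0; have d0' : det3 b c a != 0 by rewrite det3_rot.
have d0'' : det3 c a b != 0 by rewrite det3_rot.
apply/seteqP; split=> [p|p [? ? ?]].
  move=> [u [v [w [u0 v0 w0 s ->]]]].
  have E1 : u *: a + v *: b + w *: c = v *: b + w *: c + u *: a by rewrite -addrA addrC.
  have E2 : u *: a + v *: b + w *: c = w *: c + u *: a + v *: b by rewrite addrC addrA.
  split; first by rewrite (baryE d0 s).
  - by rewrite E1 (baryE d0')// -s addrC addrA.
  - by rewrite E2 (baryE d0'')// -s -addrA addrC.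
exists (bary a b c p), (bary b c a p), (bary c a b p).
by split => //; [exact: bary_sum|exact: bary_comb].
Qed.

Let H0 : set (R * R) := [set q | [/\ 0 < q.1, 0 <= q.2 & q.1 + q.2 <= 1]].
Let H1 : set (R * R) := [set q | [/\ 0 < q.1, 0 <= q.2 & q.1 + q.2 < 1]].

(** The line is the preimage of the horizontal axis under a shear, and the axis is a product with a
    null factor. *)
Let area_line0_snd (a b c : R) : b != 0 ->
  area [set p : R * R | a * p.1 + b * p.2 + c = 0] = 0%E.
Proof.
move=> b0; pose Z : set (T * T) := setT `*` [set 0].
have mZ : measurable Z by exact: measurableX.
have -> : [set p : R * R | a * p.1 + b * p.2 + c = 0] =
          [set p | Z (p.1, b * p.2 + (a * p.1 + c))].
  apply/seteqP; split => p /=; rewrite /Z/=; last by case=> _ <-; ring.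
  by move=> h; split => //; rewrite -h; ring.
rewrite (area_shear (fun x => a * x + c) b0 mZ).
by rewrite /area product_measure1E//= lebesgue_measure_set1 !mule0.
Qed.

Lemma measurable_line (a b c : R) :
  measurable ([set p | a * p.1 + b * p.2 + c = 0] : set (T * T)).
Proof.
have -> : [set p : R * R | a * p.1 + b * p.2 + c = 0] =
    [set p | 0 <= a * p.1 + b * p.2 + c] `&` [set p | 0 <= - a * p.1 + - b * p.2 + - c].
  by apply/seteqP; split => p /=; [move=> ?; split; lra|move=> [? ?]; lra].
by apply: measurableI; exact: measurable_halfplane.
Qed.

Lemma area_line0 (a b c : R) : (a != 0) || (b != 0) ->
  area [set p : R * R | a * p.1 + b * p.2 + c = 0] = 0%E.
Proof.
have [->/= |b0 _] := eqVneq b 0; last exact: area_line0_snd.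
rewrite orbF => a0; rewrite -area_swap; last exact: measurable_line.
rewrite -(area_line0_snd 0 c a0); congr area; apply/funext => p /=.
by rewrite !mul0r addr0 add0r.
Qed.

Let mH0 : measurable (H0 : set (T * T)).
Proof.
have -> : H0 = [set p | 0 < 1 * p.1 + 0 * p.2 + 0] `&`
    [set p | 0 <= 0 * p.1 + 1 * p.2 + 0] `&` [set p | 0 <= -1 * p.1 + -1 * p.2 + 1].
  by apply/seteqP; split => p; rewrite /H0/=;
    [move=> [? ? ?]; (repeat split); lra|move=> [[? ?] ?]; split; lra].
apply: measurableI; last exact: measurable_halfplane.
by apply: measurableI; [exact: measurable_open_halfplane|exact: measurable_halfplane].
Qed.

Let mH1 : measurable (H1 : set (T * T)).
Proof.
have -> : H1 = [set p | 0 < 1 * p.1 + 0 * p.2 + 0] `&`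
    [set p | 0 <= 0 * p.1 + 1 * p.2 + 0] `&` [set p | 0 < -1 * p.1 + -1 * p.2 + 1].
  by apply/seteqP; split => p; rewrite /H1/=;
    [move=> [? ? ?]; (repeat split); lra|move=> [[? ?] ?]; split; lra].
apply: measurableI; last exact: measurable_open_halfplane.
by apply: measurableI; [exact: measurable_open_halfplane|exact: measurable_halfplane].
Qed.

(** Meant for a triangle with and without one side, [L] being the line through that side. *)
Lemma area_ext0 (A B L : set (T * T)) : measurable A -> measurable B ->
  measurable L -> area L = 0%E -> A `<=` B -> B `<=` A `|` L -> area B = area A.
Proof.
move=> mA mB mL L0 AB BAL; apply/eqP; rewrite eq_le; apply/andP; split; last first.
  by apply: le_measure; rewrite ?inE.
rewrite -[leRHS]adde0 -L0; apply: le_trans (measureU2 _ mA mL).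
by apply: le_measure; rewrite ?inE//; exact: measurableU.
Qed.

Let H01 : area H0 = area H1.
Proof.
apply: (area_ext0 mH1 mH0 (measurable_line 1 1 (-1))).
- by apply: area_line0; rewrite oner_neq0.
- by move=> p [? ? ?]; split=> //; exact: ltW.
- move=> p [? ? ?]; have [?|?] := ltP (p.1 + p.2) 1; [by left|right=> /=; lra].
Qed.

(** The half-open unit square is the disjoint union of [H0] and the mirror image [H2] of [H1] in the
    line [x + y = 1]; both parts have the same area by [H01]. *)
Let areaH0 : area H0 = (1 / 2)%:E.
Proof.
pose Q : set (T * T) := `]0%R, 1%R]%classic `*` `[0%R, 1%R[%classic.
have mQ : measurable Q by apply: measurableX; exact: measurable_itv.
pose H2 := [set q : R * R | H1 (0 * q.1 + (-1) * q.2 + 1, (-1) * q.1 + 0 * q.2 + 1)].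
have mH2 : measurable (H2 : set (T * T)) by exact: measurable_affine_preimage.
have QE : Q = H0 `|` H2.
  apply/seteqP; split=> -[x y]; rewrite /Q /H0 /H2 /H1 /= !in_itv/=.
    move=> [/andP[? ?] /andP[? ?]]; have [?|?] := leP (x + y) 1; first by left.
    by right; split; lra.
  by move=> [|] [? ? ?]; split; apply/andP; split; lra.
have H02 : H0 `&` H2 = set0.
  clear QE; apply/seteqP; split=> -[x y] //=; rewrite /H0 /H2 /H1 /= => -[[? ? ?] [? ? ?]]; lra.
have : area Q = (area H0 + area H2)%E by rewrite QE; exact: measureU.
rewrite {1}/area product_measure1E; [|exact: measurable_itv|exact: measurable_itv].
rewrite /= !lebesgue_measure_itv/= lte_fin ltr01 -EFinB subr0 mule1.
rewrite (area_affine_preimage _ _ _ mH1); last by rewrite mul0r sub0r mulN1r opprK oppr_eq0 oner_eq0.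
rewrite mul0r sub0r mulN1r opprK normrN normr1 invr1 mul1e -H01.
have : (0 <= area H0)%E by exact: measure_ge0.
case: (area H0) => [r| |]//; rewrite -EFinD => _ [h]; congr EFin; lra.
Qed.

Lemma measurable_half_triangle a b c : measurable (half_triangle a b c : set (T * T)).
Proof.
have [x [y [z E]]] := bary_affine a b c.
have [x' [y' [z' E']]] := bary_affine b c a.
have [x'' [y'' [z'' E'']]] := bary_affine c a b.
have -> : half_triangle a b c = [set p | 0 < x * p.1 + y * p.2 + z] `&`
  [set p | 0 <= x' * p.1 + y' * p.2 + z'] `&` [set p | 0 <= x'' * p.1 + y'' * p.2 + z''].
  by apply/seteqP; split=> p; rewrite /half_triangle/= E E' E''; [move=> [? ? ?]|move=> [[? ?] ?]].
apply: measurableI; last exact: measurable_halfplane.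
by apply: measurableI; [exact: measurable_open_halfplane|exact: measurable_halfplane].
Qed.

(** The first two barycentric coordinates form an affine map of determinant [1 / det3 a b c] that
    pulls the standard triangle [H0] back to this one. *)
Lemma area_half_triangle a b c : det3 a b c != 0 ->
  area (half_triangle a b c) = (`|det3 a b c| / 2)%:E.
Proof.
move=> d0; have d0' : det3 b c a != 0 by rewrite det3_rot.
pose d := det3 a b c.
have -> : half_triangle a b c = [set p : R * R | H0
   ((b.2 - c.2) / d * p.1 + (c.1 - b.1) / d * p.2 + (b.1 * c.2 - b.2 * c.1) / d,
    (c.2 - a.2) / d * p.1 + (a.1 - c.1) / d * p.2 + (c.1 * a.2 - c.2 * a.1) / d)].
  have E1 p : bary a b c p =
      (b.2 - c.2) / d * p.1 + (c.1 - b.1) / d * p.2 + (b.1 * c.2 - b.2 * c.1) / d.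
    by rewrite !(mulrAC _ _^-1) -!mulrDl; congr (_ / _); rewrite /det3; ring.
  have E2 p : bary b c a p =
      (c.2 - a.2) / d * p.1 + (a.1 - c.1) / d * p.2 + (c.1 * a.2 - c.2 * a.1) / d.
    rewrite !(mulrAC _ _^-1) -!mulrDl /bary (det3_rot a b c).
    by congr (_ / _); rewrite /det3; ring.
  apply/funext => p; rewrite /half_triangle /H0 /= -E1 -E2 -(bary_sum p d0).
  by rewrite lerDl.
have dE : (b.2 - c.2) / d * ((a.1 - c.1) / d) - (c.2 - a.2) / d * ((c.1 - b.1) / d) = d^-1.
  set e := d^-1; transitivity (d * e * e); first by rewrite /d /det3; ring.
  by rewrite /e mulfV// mul1r.
rewrite area_affine_preimage// dE ?invr_eq0//.
by rewrite areaH0 -EFinM normfV invrK; congr EFin; rewrite mulrA mulr1.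
Qed.

Lemma area_triangle a b c : det3 a b c != 0 ->
  area (triangle a b c) = (`|det3 a b c| / 2)%:E.
Proof.
move=> d0; rewrite -(area_half_triangle d0) (triangleE d0).
have [x [y [z E]]] := bary_affine a b c.
have [x' [y' [z' E']]] := bary_affine b c a.
have [x'' [y'' [z'' E'']]] := bary_affine c a b.
apply: (area_ext0 (measurable_half_triangle a b c) _ (measurable_line x y z)).
- have -> : [set p | [/\ 0 <= bary a b c p, 0 <= bary b c a p & 0 <= bary c a b p]] =
    [set p | 0 <= x * p.1 + y * p.2 + z] `&`
    [set p | 0 <= x' * p.1 + y' * p.2 + z'] `&` [set p | 0 <= x'' * p.1 + y'' * p.2 + z''].
    by apply/seteqP; split=> p; rewrite /= E E' E''; [move=> [? ? ?]|move=> [[? ?] ?]].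
  by apply: measurableI; [apply: measurableI|]; exact: measurable_halfplane.
(* The equation of the side is nondegenerate: a constant coordinate could not be [1] at [a] and [0]
   at [b]. *)
- apply: area_line0; rewrite -negb_and; apply/negP => /andP[/eqP x0 /eqP y0].
  have bary_const p : bary a b c p = z by rewrite E x0 y0 !mul0r !add0r.
  have := bary_const a; rewrite -(bary_const b) /bary divff// => /eqP.
  by rewrite (_ : det3 b b c = 0) ?mul0r ?oner_eq0// /det3; ring.
- by move=> p [? ? ?]; split => //; exact: ltW.
- move=> p [h ? ?]; have [h0|h0] := ltP 0 (bary a b c p); first by left.
  by right; rewrite /= -E; apply/eqP; rewrite eq_le h h0.
Qed.

End triangle_area.

(** * Topology of the plane and of Jordan domains *)

Section plane_topology.
Context {R : realType}.
Local Notation T := (measurableTypeR R).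
Implicit Types (p q : R * R) (D : set (R * R)).

Lemma nbhs_planeP p (A : set (R * R)) : nbhs p A <->
  exists2 e, 0 < e & forall q, `|q.1 - p.1| < e -> `|q.2 - p.2| < e -> A q.
Proof.
split=> [/nbhs_ballP[e e0 eA]|[e e0 eA]].
  exists e => // q q1 q2; apply: eA; split => /=; rewrite /ball/=.
    by rewrite distrC.
  by rewrite distrC.
apply/nbhs_ballP; exists e => // q [q1 q2]; apply: eA; rewrite distrC.
  exact: q1.
exact: q2.
Qed.

(** An open set is the union of the countably many boxes with rational centre and rational radius
    that it contains. *)
Lemma open_plane_measurable (U : set (R * R)) : open U -> measurable (U : set (T * T)).
Proof.
move=> oU.
pose box (a b r : rat) : set (T * T) :=
  `]ratr a - ratr r : R, ratr a + ratr r[%classic `*`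
  `]ratr b - ratr r : R, ratr b + ratr r[%classic.
pose F (a b r : rat) : set (T * T) := if `[< box a b r `<=` U >] then box a b r else set0.
have -> : U = \bigcup_a \bigcup_b \bigcup_r F a b r.
  apply/seteqP; split=> [p Up|p [a _ [b _ [r _]]]]; last first.
    by rewrite /F; case: asboolP => // sub /sub.
  have /nbhs_planeP[e e0 eU] : nbhs p U by exact: open_nbhs_nbhs.
  (* A box of radius [r] whose centre is within [r] of [p] stays within [2 r] of [p], so [r < e / 2]
     suffices. *)
  have e20 : 0 < e / 2 by rewrite divr_gt0.
  have [r] := rat_in_itvoo e20; rewrite in_itv/= => /andP[r0 re].
  have H (x : R) : x - ratr r < x + ratr r by lra.
  have [a] := rat_in_itvoo (H p.1); rewrite in_itv/= => /andP[a1 a2].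
  have [b] := rat_in_itvoo (H p.2); rewrite in_itv/= => /andP[b1 b2].
  exists a => //; exists b => //; exists r => //.
  rewrite /F; case: asboolP => [_|[]].
    by split => /=; rewrite in_itv/=; apply/andP; split; lra.
  move=> q []; rewrite /= !in_itv/= => /andP[q1 q2] /andP[q3 q4]; apply: eU.
    by rewrite ltr_norml; apply/andP; split; lra.
  by rewrite ltr_norml; apply/andP; split; lra.
apply: bigcupT_measurable_rat => a; apply: bigcupT_measurable_rat => b.
apply: bigcupT_measurable_rat => r; rewrite /F; case: asboolP => // _.
by apply: measurableX; exact: measurable_itv.
Qed.

Lemma plane_hausdorff : hausdorff_space (R * R)%type.
Proof. exact: (@norm_hausdorff R (R * R)%type). Qed.

Lemma compact_plane_closed D : compact D -> closed D.
Proof. exact: compact_closed plane_hausdorff. Qed.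

Lemma compact_plane_measurable D : compact D -> measurable (D : set (T * T)).
Proof.
move=> /compact_plane_closed cD; rewrite -(setCK D); apply: measurableC.
by apply: open_plane_measurable; exact: closed_openC.
Qed.

Lemma continuous_fst2 : continuous (fst : R * R -> R).
Proof. by move=> p; exact: cvg_fst. Qed.

Lemma continuous_snd2 : continuous (snd : R * R -> R).
Proof. by move=> p; exact: cvg_snd. Qed.

Lemma continuous_affine2 (a b c : R) : continuous (fun p : R * R => a * p.1 + b * p.2 + c).
Proof.
move=> p; apply: cvgD; last exact: cvg_cst.
by apply: cvgD; apply: cvgMr; [exact: continuous_fst2|exact: continuous_snd2].
Qed.

Lemma edist_continuous p : continuous (fun q : R * R => edist q p).
Proof.
move=> q; apply: (@continuous_comp _ _ _ (fun q : R * R => (q.1 - p.1) ^+ 2 + (q.2 - p.2) ^+ 2)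
   Num.sqrt); last exact: sqrt_continuous.
apply: cvgD; rewrite /=.
  apply: (@continuous_comp _ _ _ (fun q : R * R => q.1 - p.1) (fun x => x ^+ 2)).
    by apply: cvgB; [exact: continuous_fst2|exact: cvg_cst].
  exact: exprn_continuous.
apply: (@continuous_comp _ _ _ (fun q : R * R => q.2 - p.2) (fun x => x ^+ 2)).
  by apply: cvgB; [exact: continuous_snd2|exact: cvg_cst].
exact: exprn_continuous.
Qed.

Lemma edist_fst p q : `|p.1 - q.1| <= edist p q.
Proof. by rewrite -sqrtr_sqr ler_sqrt ?lerDl ?sqr_ge0// addr_ge0 ?sqr_ge0. Qed.

Lemma edist_snd p q : `|p.2 - q.2| <= edist p q.
Proof. by rewrite -sqrtr_sqr ler_sqrt ?lerDr ?sqr_ge0// addr_ge0 ?sqr_ge0. Qed.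

Lemma compact_disc : compact [set x : R * R | edist x 0 <= 1].
Proof.
pose B : set (R * R) := `[-1, 1]%classic `*` `[-1, 1]%classic.
apply: (@subclosed_compact (R * R)%type _ B).
- have := @closed_comp _ _ (fun q : R * R => edist q 0) [set x : R | x <= 1].
  apply; last exact: closed_le.
  by move=> x _; exact: edist_continuous.
- by apply: compact_setX; exact: segment_compact.
- move=> p /= p1; rewrite /B /=.
  suff : `|p.1| <= 1 /\ `|p.2| <= 1 by rewrite !ler_norml => -[h1 h2]; split; rewrite /= in_itv.
  by split; apply: le_trans p1; [have := edist_fst p 0|have := edist_snd p 0]; rewrite subr0.
Qed.

Lemma jordan_compact D : jordan_domain D -> compact D.
Proof.
move=> [f [g [cf cg fD gD [gf fg]]]].
have -> : D = f @` [set x : R * R | edist x 0 <= 1].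
  apply/seteqP; split=> // y Dy; exists (g y); last exact: fg.
  by apply: gD; exists y.
exact: continuous_compact cf compact_disc.
Qed.

Lemma within_continuous_comp2 (U V W : topologicalType) (A : set U) (B : set V)
    (f : U -> W) (h : V -> U) :
  {within A, continuous f} -> {within B, continuous h} -> h @` B `<=` A ->
  {within B, continuous (f \o h)}.
Proof.
move=> /subspace_continuousP cf /subspace_continuousP ch hBA.
apply/subspace_continuousP => x Bx P fP.
have := cf (h x) (hBA _ (ex_intro2 _ _ _ Bx erefl)) _ fP.
rewrite /= /within/= => /(ch x Bx); rewrite /nbhs/= /within/=.
by apply: filterS => y + By; apply => //; apply: hBA; exists y.
Qed.

(* Along the unit circle a continuous real function takes the same value at some
   pair of antipodal points, so it is not injective. *)
Lemma jordan_not_line D (a b c : R) : jordan_domain D -> (a != 0) || (b != 0) ->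
  ~ (forall p, D p -> a * p.1 + b * p.2 = c).
Proof.
move=> [f [g [cf cg fD gD [gf fg]]]] ab0 Dl.
pose disc := [set x : R * R | edist x 0 <= 1].
(* [L] is a coordinate along the line: on it, equal values of [L] mean equal points. *)
pose L (p : R * R) : R := (- b) * p.1 + a * p.2 + 0.
have cL : {within disc, continuous (L \o f)}.
  by apply: within_continuous_comp cf => p _; exact: continuous_affine2.
pose z (e : R) (t : R) : R * R := (e * cos t, e * sin t).
have cz e : continuous (z e).
  move=> t; apply: (@cvg_pair _ _ _ (nbhs t) (nbhs (e * cos t)) (nbhs (e * sin t)) _ _ _
    (fun t => e * cos t) (fun t => e * sin t)).
    by apply: cvgMr; exact: continuous_cos.
  by apply: cvgMr; exact: continuous_sin.
have zdisc e t : e ^+ 2 = 1 -> disc (z e t).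
  move=> e1; rewrite /disc /z /edist/= !subr0 !exprMn e1 !mul1r cos2Dsin2.
  by rewrite sqrtr1.
have cLz e : e ^+ 2 = 1 -> {within `[0, pi], continuous (L \o f \o z e)}.
  move=> e1; apply: (within_continuous_comp2 cL); first exact: continuous_subspaceT.
  by move=> _ [t _ <-]; exact: zdisc.
pose k : R -> R := (L \o f \o z 1) \- (L \o f \o z (-1)).
have ck : {within `[0, pi], continuous k}.
  by apply: within_continuousB; apply: cLz; rewrite ?sqrrN expr1n.
have k0pi : k pi = - k 0.
  by rewrite /k /z/= cospi sinpi cos0 sin0 !mulr0 !mulr1 !mul1r mulN1r opprK opprB.
have kr : Num.min (k 0) (k pi) <= 0 <= Num.max (k 0) (k pi).
  rewrite k0pi; have [h|h] := leP 0 (k 0).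
    by rewrite ge_min oppr_le0 h orbT/= le_max h.
  by rewrite ge_min (ltW h)/= le_max oppr_ge0 (ltW h) orbT.
have [t t0pi kt] := IVT (pi_ge0 R) ck kr.
have d1 : disc (z 1 t) by apply: zdisc; rewrite expr1n.
have d2 : disc (z (-1) t) by apply: zdisc; rewrite sqrrN expr1n.
have H1 := Dl _ (fD _ (ex_intro2 _ _ _ d1 erefl)).
have H2 := Dl _ (fD _ (ex_intro2 _ _ _ d2 erefl)).
have E : f (z 1 t) = f (z (-1) t).
  move: kt H1 H2; rewrite /k /L /=.
  move: (f (z 1 t)) (f (z (-1) t)) => [x y] [x' y'] /= h1 h2 h3.
  have n0 : a ^+ 2 + b ^+ 2 != 0.
    by rewrite paddr_eq0 ?sqr_ge0// !sqrf_eq0 negb_and.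
  have h4 : - b * x + a * y = - b * x' + a * y' by move: h1; lra.
  have Ex u v : (a ^+ 2 + b ^+ 2) * u = a * (a * u + b * v) - b * (- b * u + a * v) by ring.
  have Ey u v : (a ^+ 2 + b ^+ 2) * v = b * (a * u + b * v) + a * (- b * u + a * v) by ring.
  by congr pair; apply: (mulfI n0); [rewrite (Ex x y) (Ex x' y') h2 h3 h4|
    rewrite (Ey x y) (Ey x' y') h2 h3 h4].
have : z 1 t = z (-1) t by rewrite -[LHS]gf// E gf.
rewrite /z /= !mul1r !mulN1r => -[h1 h2].
have := cos2Dsin2 t.
by rewrite (_ : cos t = 0) 1?(_ : sin t = 0) ?expr0n/=; lra.
Qed.

End plane_topology.

(** * The isominwidth inequality *)

Section isominwidth.
Context {R : realType}.
Local Notation T := (measurableTypeR R).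
Implicit Types (a b c p q : R * R) (D : set (R * R)).

Lemma bary_continuous a b c : continuous (bary a b c).
Proof.
have [x [y [z E]]] := bary_affine a b c.
rewrite (_ : bary a b c = fun p => x * p.1 + y * p.2 + z); last exact/funext.
exact: continuous_affine2.
Qed.

Lemma convex_comb D p q (t : R) : @convex_set R (R * R)%type D ->
  0 <= t -> t <= 1 -> D p -> D q -> D (t *: p + (1 - t) *: q).
Proof.
move=> cD t0 t1 Dp Dq.
have t01 : 0 <= t <= 1 by rewrite t0.
have := cD p q (Itv01 t0 t1); rewrite !inE; exact.
Qed.

Lemma convex_comb3 D a b c (u v w : R) : @convex_set R (R * R)%type D ->
  0 <= u -> 0 <= v -> 0 <= w -> u + v + w = 1 -> D a -> D b -> D c ->
  D (u *: a + v *: b + w *: c).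
Proof.
move=> cD u0 v0 w0 s Da Db Dc.
have [vw0|vw0] := eqVneq (v + w) 0.
  have -> : v = 0 by lra.
  have -> : w = 0 by lra.
  have -> : u = 1 by lra.
  by rewrite !scale0r !addr0 scale1r.
have -> : u *: a + v *: b + w *: c =
    u *: a + (1 - u) *: (v / (v + w) *: b + (1 - v / (v + w)) *: c).
  have -> : 1 - u = v + w by lra.
  rewrite scalerDr !scalerA mulrBr mulr1 -addrA.
  have E : (v + w) * (v / (v + w)) = v by rewrite mulrC divfK.
  by rewrite E (_ : v + w - v = w) //; ring.
have vwp : 0 < v + w by rewrite lt_neqAle eq_sym vw0; lra.
apply: convex_comb => //; first lra.
apply: convex_comb => //; first by rewrite divr_ge0// ltW.
by rewrite ler_pdivrMr// mul1r; lra.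
Qed.

Lemma bary_lin a b c p q r (u v w : R) : u + v + w = 1 ->
  bary a b c (u *: p + v *: q + w *: r) =
  u * bary a b c p + v * bary a b c q + w * bary a b c r.
Proof.
move=> s; have [x [y [z E]]] := bary_affine a b c.
rewrite !E /= /GRing.scale/=.
have -> : u = 1 - v - w by rewrite -s; ring.
ring.
Qed.

Lemma bary1 a b c : det3 a b c != 0 -> bary a b c a = 1.
Proof. by move=> d; rewrite /bary divff. Qed.

Lemma bary0l a b c : bary a b c b = 0.
Proof. by rewrite /bary (_ : det3 b b c = 0) ?mul0r// /det3; ring. Qed.

Lemma bary0r a b c : bary a b c c = 0.
Proof. by rewrite /bary (_ : det3 c b c = 0) ?mul0r// /det3; ring. Qed.

(* The set [E] is the triangle [b c p] without its side [b c]. *)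
Lemma outer_triangle D a b c p : @convex_set R (R * R)%type D -> 0 < det3 a b c ->
  D b -> D c -> D p ->
  bary a b c p <= 0 -> 0 <= bary b c a p -> 0 <= bary c a b p ->
  exists E : set (T * T), [/\ measurable E, E `<=` D,
    forall q, E q -> [/\ bary a b c q < 0, 0 <= bary b c a q & 0 <= bary c a b q] &
    area E = (- bary a b c p * det3 a b c / 2)%:E].
Proof.
move=> cD d0 Db Dc Dp pa pb pc.
have [p0|p0] := eqVneq (bary a b c p) 0.
  by exists set0; split => //; rewrite p0 oppr0 !mul0r /area measure0.
have pa0 : bary a b c p < 0 by rewrite lt_neqAle p0.
have dE : det3 p b c = bary a b c p * det3 a b c by rewrite divfK// gt_eqF.
have dp : det3 p b c != 0 by rewrite dE mulf_neq0// gt_eqF.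
have da : det3 b c a != 0 by rewrite det3_rot gt_eqF.
have db : det3 c a b != 0 by rewrite det3_rot.
exists (half_triangle p b c); split.
- exact: measurable_half_triangle.
- move=> q [u v w]; rewrite (bary_comb q dp).
  by apply: convex_comb3 => //; [exact: ltW|exact: bary_sum].
- move=> q [u v w]; have s := bary_sum q dp; rewrite (bary_comb q dp).
  rewrite !bary_lin// bary0l bary0r bary0l bary0r !bary1//; split.
  + by rewrite !mulr0 !addr0 nmulr_llt0.
  + by rewrite mulr0 addr0 mulr1 addr_ge0// mulr_ge0// ltW.
  + by rewrite mulr0 addr0 mulr1 addr_ge0// mulr_ge0// ltW.
- by rewrite area_half_triangle// dE normrM (ltr0_norm pa0) (gtr0_norm d0).
Qed.

(** Exchanging two vertices changes the sign of [det3], so the largest signed value is also the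
    largest absolute value. *)
Lemma max_triangle D : compact D -> D !=set0 ->
  exists a b c, [/\ D a, D b, D c & forall p q r, D p -> D q -> D r -> det3 p q r <= det3 a b c].
Proof.
move=> cD D0.
pose f (x : (R * R) * ((R * R) * (R * R))) : R := det3 x.1 x.2.1 x.2.2.
have ca1 : continuous (fun x : (R * R) * ((R * R) * (R * R)) => x.1.1).
  by move=> x; apply: (@continuous_comp _ _ _ fst fst); exact: cvg_fst.
have ca2 : continuous (fun x : (R * R) * ((R * R) * (R * R)) => x.1.2).
  by move=> x; apply: (@continuous_comp _ _ _ fst snd); [exact: cvg_fst|exact: cvg_snd].
have cs : continuous (snd : (R * R) * ((R * R) * (R * R)) -> _) by move=> x; exact: cvg_snd.
have cb1 : continuous (fun x : (R * R) * ((R * R) * (R * R)) => x.2.1.1).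
  move=> x; apply: (@continuous_comp _ _ _ snd (fun y => y.1.1)); first exact: cs.
  by apply: (@continuous_comp _ _ _ fst fst); exact: cvg_fst.
have cb2 : continuous (fun x : (R * R) * ((R * R) * (R * R)) => x.2.1.2).
  move=> x; apply: (@continuous_comp _ _ _ snd (fun y => y.1.2)); first exact: cs.
  by apply: (@continuous_comp _ _ _ fst snd); [exact: cvg_fst|exact: cvg_snd].
have cc1 : continuous (fun x : (R * R) * ((R * R) * (R * R)) => x.2.2.1).
  move=> x; apply: (@continuous_comp _ _ _ snd (fun y => y.2.1)); first exact: cs.
  by apply: (@continuous_comp _ _ _ snd fst); [exact: cvg_snd|exact: cvg_fst].
have cc2 : continuous (fun x : (R * R) * ((R * R) * (R * R)) => x.2.2.2).
  move=> x; apply: (@continuous_comp _ _ _ snd (fun y => y.2.2)); first exact: cs.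
  by apply: (@continuous_comp _ _ _ snd snd); exact: cvg_snd.
have cf : continuous f.
  move=> x; apply: cvgB; apply: cvgM; apply: cvgB;
    [exact: cb1|exact: ca1|exact: cc2|exact: ca2|exact: cb2|exact: ca2|exact: cc1|exact: ca1].
have cD3 : compact (D `*` (D `*` D)) by apply: compact_setX => //; exact: compact_setX.
have D30 : D `*` (D `*` D) !=set0 by case: D0 => x Dx; exists (x, (x, x)).
have cfw : {within D `*` (D `*` D), continuous f} by exact: continuous_subspaceT.
have [[a [b c]]] := compact_EVT_max D30 cD3 cfw.
rewrite inE => -[/= Da [/= Db Dc]] h; exists a, b, c; split => // p q r Dp Dq Dr.
by apply: (h (p, (q, r))); rewrite inE; split.
Qed.

Lemma amgm3 (x y z : R) : 0 <= x -> 0 <= y -> 0 <= z -> 27 * (x * y * z) <= (x + y + z) ^+ 3.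
Proof.
move=> x0 y0 z0; rewrite -subr_ge0.
have -> : (x + y + z) ^+ 3 - 27 * (x * y * z) =
  (x + y + z) * ((x - y) ^+ 2 + (y - z) ^+ 2 + (z - x) ^+ 2) / 2 +
  3 * (x * (y - z) ^+ 2 + y * (z - x) ^+ 2 + z * (x - y) ^+ 2) by field.
have hx := mulr_ge0 x0 (sqr_ge0 (y - z)).
have hy := mulr_ge0 y0 (sqr_ge0 (z - x)).
have hz := mulr_ge0 z0 (sqr_ge0 (x - y)).
rewrite addr_ge0//; last by lra.
rewrite divr_ge0// mulr_ge0 ?addr_ge0 ?sqr_ge0//.
Qed.

(** The hypothesis is Heron's formula with [S] equal to twice the area. The inequality of arithmetic
    and geometric means bounds the product of the last three factors, whose sum is the perimeter. *)
Lemma isoperimetric_triangle (l m n S : R) : 0 <= l -> 0 <= m -> 0 <= n -> 0 < S ->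
  4 * S ^+ 2 = (l + m + n) * (m + n - l) * (n + l - m) * (l + m - n) ->
  6 * Num.sqrt 3 * S <= (l + m + n) ^+ 2.
Proof.
move=> l0 m0 n0 S0 heron.
have P0 : 0 < 4 * S ^+ 2 by rewrite mulr_gt0// exprn_gt0.
set x := m + n - l in heron *; set y := n + l - m in heron *; set z := l + m - n in heron *.
have xy : 0 <= x + y by rewrite /x /y; lra.
have yz : 0 <= y + z by rewrite /y /z; lra.
have zx : 0 <= z + x by rewrite /z /x; lra.
have p0 : 0 <= l + m + n by rewrite !addr_ge0.
have pE : l + m + n = x + y + z by rewrite /x /y /z; ring.
move: heron p0; rewrite pE => heron p0; rewrite heron in P0.
have h : 27 * (x * y * z) <= (x + y + z) ^+ 3.
  (* The triangle inequalities follow from the positivity of Heron's product: the factors have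
     nonnegative pairwise sums, so if one were negative the other two would be positive. *)
  have pos (u v t : R) : 0 <= u + v -> 0 <= t + u ->
      0 < (x + y + z) * (u * (v * t)) -> 0 <= u.
    move=> uv tu P; rewrite leNgt; apply/negP => u0.
    have vt : 0 < v * t by rewrite mulr_gt0//; lra.
    have ut : u * (v * t) < 0 by rewrite nmulr_rlt0.
    by move: P; rewrite ltNge => /negP; apply; rewrite mulr_ge0_le0// ltW.
  apply: amgm3; [apply: (pos x y z)|apply: (pos y z x)|apply: (pos z x y)] => //.
  - by move: P0; rewrite !mulrA.
  - by rewrite (_ : _ * _ = (x + y + z) * x * y * z)//; ring.
  - by rewrite (_ : _ * _ = (x + y + z) * x * y * z)//; ring.
have s3 : Num.sqrt 3 ^+ 2 = 3 :> R by rewrite sqr_sqrtr.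
rewrite -(@ler_pXn2r _ 2)// ?nnegrE; last 2 first.
- by rewrite !mulr_ge0// ltW.
- exact: sqr_ge0.
rewrite -exprM (_ : (6 * Num.sqrt 3 * S) ^+ 2 = 27 * (4 * S ^+ 2)); last first.
  by rewrite !exprMn s3; ring.
rewrite heron (_ : 27 * _ = (x + y + z) * (27 * (x * y * z))); last by ring.
by rewrite (_ : (2 * 2)%N = 4%N)// exprS ler_wpM2l.
Qed.

(** Here [S] is twice the area of the inscribed triangle, so its heights are [S / l], [S / m],
    [S / n] and the isoperimetric constant is [6 sqrt 3]. *)
Lemma isominwidth_arith (w S al be ga l m n : R) : 0 <= w -> 0 < S ->
  0 <= al <= 1 -> 0 <= be <= 1 -> 0 <= ga <= 1 ->
  0 <= l -> 0 <= m -> 0 <= n ->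
  w * l <= S * (1 + al) -> w * m <= S * (1 + be) -> w * n <= S * (1 + ga) ->
  6 * Num.sqrt 3 * S <= (l + m + n) ^+ 2 ->
  w ^+ 2 / Num.sqrt 3 <= S * (1 + al + be + ga) / 2.
Proof.
move=> w0 S0 /andP[a0 a1] /andP[b0 b1] /andP[c0 c1] l0 m0 n0 hl hm hn iso.
have s3 : Num.sqrt 3 ^+ 2 = 3 :> R by rewrite sqr_sqrtr.
have s30 : 0 < Num.sqrt 3 :> R by rewrite sqrtr_gt0.
pose s := 1 + al + be + ga.
have h1 : w * (l + m + n) <= S * (2 + s) by rewrite /s; lra.
have h2 : w ^+ 2 * (6 * Num.sqrt 3 * S) <= S ^+ 2 * (2 + s) ^+ 2.
  apply: (@le_trans _ _ (w ^+ 2 * (l + m + n) ^+ 2)).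
    by rewrite ler_wpM2l// sqr_ge0.
  rewrite -!exprMn ler_pXn2r// ?nnegrE.
    by rewrite mulr_ge0// !addr_ge0.
  by rewrite mulr_ge0 ?(ltW S0)// /s; lra.
have h3 : (2 + s) ^+ 2 <= 9 * s.
  have : 0 <= (s - 1) * (4 - s) by rewrite mulr_ge0// /s; lra.
  by rewrite expr2; lra.
have h4 : w ^+ 2 * (6 * Num.sqrt 3) <= S * (9 * s).
  rewrite -(ler_pM2r S0); apply: (@le_trans _ _ (S ^+ 2 * (2 + s) ^+ 2)).
    by rewrite -mulrA.
  rewrite (_ : S * (9 * s) * S = S ^+ 2 * (9 * s)); last by ring.
  by rewrite ler_wpM2l// sqr_ge0.
rewrite ler_pdivrMr//.
rewrite -(@ler_pM2r _ (6 * Num.sqrt 3)) ?mulr_gt0//.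
apply: (le_trans h4); rewrite le_eqVlt; apply/orP; left; apply/eqP.
transitivity (3 * S * s * Num.sqrt 3 ^+ 2); first by rewrite s3; ring.
by rewrite /s; field.
Qed.

(** If the maximum were not positive, antisymmetry would make every [det3] on [D] vanish, and [D]
    would lie on the line through two of its points. *)
Lemma max_triangle_gt0 D : compact D ->
  (forall x y z : R, (x != 0) || (y != 0) -> ~ (forall p, D p -> x * p.1 + y * p.2 = z)) ->
  exists a b c, [/\ D a, D b, D c, 0 < det3 a b c &
    forall p q r, D p -> D q -> D r -> det3 p q r <= det3 a b c].
Proof.
move=> cD nl.
have [p Dp] : D !=set0.
  apply/set0P/eqP => D0; apply: (nl 1 0 0); first by rewrite oner_neq0.
  by move=> p; rewrite D0.
have [a [b [c [Da Db Dc h]]]] := max_triangle cD (ex_intro _ p Dp).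
exists a, b, c; split => //; rewrite ltNge; apply/negP => d0.
have det0 x y z : D x -> D y -> D z -> det3 x y z = 0.
  move=> Dx Dy Dz; apply/eqP; rewrite eq_le (le_trans (h _ _ _ Dx Dy Dz) d0)/=.
  rewrite -oppr_le0 (_ : - _ = det3 x z y); last by rewrite /det3; ring.
  exact: le_trans (h _ _ _ Dx Dz Dy) d0.
(* A one-point set lies on a vertical line. *)
have [q [Dq qp]] : exists q, D q /\ q != p.
  apply: contrapT => /forallNP nq; apply: (nl 1 0 p.1); first by rewrite oner_neq0.
  move=> q Dq; have := nq q; rewrite not_andP => -[//|/negP]; rewrite negbK => /eqP ->.
  by rewrite mul1r mul0r addr0.
apply: (nl (p.2 - q.2) (q.1 - p.1) (p.2 * q.1 - q.2 * p.1)).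
  apply: contraNT qp; rewrite negb_or !negbK !subr_eq0 => /andP[/eqP h1 /eqP h2].
  by apply/eqP; rewrite [LHS]surjective_pairing h2 -h1 -surjective_pairing.
by move=> r Dr; have := det0 _ _ _ Dp Dq Dr; rewrite /det3; lra.
Qed.

Theorem isominwidth D (w : R) : compact D -> @convex_set R (R * R)%type D ->
  (forall x y z : R, (x != 0) || (y != 0) -> ~ (forall p, D p -> x * p.1 + y * p.2 = z)) ->
  0 <= w ->
  (forall x y m M : R, (x != 0) || (y != 0) ->
    (forall p, D p -> m <= x * p.1 + y * p.2 <= M) ->
    w * Num.sqrt (x ^+ 2 + y ^+ 2) <= M - m) ->
  ((w ^+ 2 / Num.sqrt 3)%:E <= area D)%E.
Proof.
move=> cD vD nl w0 width.
have [a [b [c [Da Db Dc S0 maxS]]]] := max_triangle_gt0 cD nl.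
have mD := compact_plane_measurable cD.
have Sb : det3 b c a = det3 a b c by exact: det3_rot.
have Sc : det3 c a b = det3 a b c by rewrite -Sb det3_rot.
(* For one side of the maximal triangle: [E] is the outer triangle over it and [al] the height of
   [E] relative to that of the maximal triangle. *)
have main a' b' c' : D a' -> D b' -> D c' -> det3 a' b' c' = det3 a b c ->
   exists E, exists2 al : R, 0 <= al <= 1 & [/\ measurable (E : set (T * T)), E `<=` D,
    forall q, E q -> [/\ bary a' b' c' q < 0, 0 <= bary b' c' a' q & 0 <= bary c' a' b' q],
    area E = (al * det3 a b c / 2)%:E &
    w * edist b' c' <= det3 a b c * (1 + al)].
  move=> Da' Db' Dc' SE.
  have S0' : 0 < det3 a' b' c' by rewrite SE.
  have S0'' : 0 < det3 b' c' a' by rewrite det3_rot.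
  have S0''' : 0 < det3 c' a' b' by rewrite det3_rot.
  have ub p : D p -> bary a' b' c' p <= 1.
    by move=> Dp; rewrite ler_pdivrMr// mul1r SE maxS.
  have [p Dp pmin] : exists2 p, D p & forall q, D q -> bary a' b' c' p <= bary a' b' c' q.
    have cf := @continuous_subspaceT _ _ D _ (@bary_continuous a' b' c').
    have [p Dp h] := compact_EVT_min (ex_intro _ a Da) cD cf.
    by exists p; [rewrite inE in Dp|move=> q Dq; apply: h; rewrite inE].
  (* Replacing the vertex [a'] by [q] and reversing the orientation gives another inscribed
     triangle, no larger than the maximal one. *)
  have lb q : D q -> - 1 <= bary a' b' c' q.
    move=> Dq; rewrite ler_pdivlMr// mulN1r SE lerNl (_ : - _ = det3 q c' b'); last first.
      by rewrite /det3; ring.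
    exact: maxS.
  have p0 : bary a' b' c' p <= 0 by rewrite -(bary0l a' b' c') pmin.
  have sp := bary_sum p (lt0r_neq0 S0').
  have pb : bary b' c' a' p <= 1 by rewrite ler_pdivrMr// mul1r (det3_rot a' b' c') SE maxS.
  have pc : bary c' a' b' p <= 1.
    by rewrite ler_pdivrMr// mul1r (det3_rot b' c' a') (det3_rot a' b' c') SE maxS.
  have [|| E [mE ED Es aE]] := @outer_triangle D a' b' c' p vD S0' Db' Dc' Dp p0; [lra|lra|].
  exists E, (- bary a' b' c' p); first by have := lb _ Dp; lra.
  split => //; first by rewrite aE SE.
  have nz : (b'.2 - c'.2 != 0) || (c'.1 - b'.1 != 0).
    rewrite -negb_and; apply/negP => /andP[/eqP h1 /eqP h2]; move: S0'.
    rewrite (_ : det3 _ _ _ = a'.1 * (b'.2 - c'.2) + a'.2 * (c'.1 - b'.1) +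
      b'.1 * (c'.2 - b'.2) - b'.2 * (c'.1 - b'.1)); last by rewrite /det3; ring.
    by rewrite -(opprB b'.2) h1 h2 oppr0 !mulr0 !addr0 subr0 ltxx.
  (* Up to the additive constant [k], the linear form orthogonal to the side [b' c'] is
     [bary a' b' c'] times the determinant, and its gradient is as long as the side. *)
  pose k := b'.1 * c'.2 - b'.2 * c'.1.
  have -> : edist b' c' = Num.sqrt ((b'.2 - c'.2) ^+ 2 + (c'.1 - b'.1) ^+ 2).
    by rewrite /edist; congr Num.sqrt; ring.
  have -> : det3 a b c * (1 + - bary a' b' c' p) =
    det3 a b c - k - (bary a' b' c' p * det3 a b c - k) by ring.
  apply: width => //.
  move=> q Dq; have -> : (b'.2 - c'.2) * q.1 + (c'.1 - b'.1) * q.2 =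
    bary a' b' c' q * det3 a b c - k by rewrite -SE divfK ?gt_eqF// /det3 /k; ring.
  rewrite !lerD2r ler_pM2r// pmin//=.
  by rewrite ler_piMl ?(ltW S0)// ub.
have [A [al al1 [mA AD As areaA wA]]] := main a b c Da Db Dc erefl.
have [B [be be1 [mB BD Bs areaB wB]]] := main b c a Db Dc Da Sb.
have [C [ga ga1 [mC CD Cs areaC wC]]] := main c a b Dc Da Db Sc.
have S0' := lt0r_neq0 S0.
pose H : set (T * T) := half_triangle a b c.
have mH : measurable H := measurable_half_triangle a b c.
have HD : H `<=` D.
  move=> q [u v t]; rewrite (bary_comb q S0').
  by apply: convex_comb3 => //; [exact: ltW|exact: bary_sum].
(* Disjointness is read off the signs of the barycentric coordinates: each outer triangle makes
   exactly one of them negative, and [H] makes none negative. *)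
have AB : A `&` B = set0.
  by apply/seteqP; split=> // q [/As[h1 h2 h3] /Bs[h4 h5 h6]] /=; lra.
have ABC : (A `|` B) `&` C = set0.
  by apply/seteqP; split=> // q [[/As|/Bs] [h1 h2 h3] /Cs[h4 h5 h6]] /=; lra.
have ABCH : (A `|` B `|` C) `&` H = set0.
  by apply/seteqP; split=> // q [[[/As|/Bs]|/Cs] [h1 h2 h3] [h4 h5 h6]] /=; lra.
have mAB : measurable (A `|` B) by exact: measurableU.
have mABC : measurable (A `|` B `|` C) by exact: measurableU.
apply: (@le_trans _ _ (area (A `|` B `|` C `|` H))); last first.
  apply: le_measure; rewrite ?inE//; first exact: measurableU.
  by move=> q [[[/AD|/BD]|/CD]|/HD].
have -> : area (A `|` B `|` C `|` H) = (det3 a b c * (1 + al + be + ga) / 2)%:E.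
  have addU (X Y : set (T * T)) : measurable X -> measurable Y -> X `&` Y = set0 ->
      area (X `|` Y) = (area X + area Y)%E by exact: measureU.
  rewrite addU// addU// addU// areaA areaB areaC.
  rewrite /H area_half_triangle// gtr0_norm// -!EFinD; congr EFin; by field.
rewrite lee_fin.
apply: (isominwidth_arith w0 S0 al1 be1 ga1 _ _ _ wA wB wC); try exact: sqrtr_ge0.
apply: isoperimetric_triangle; rewrite ?sqrtr_ge0//.
have sq p q : edist p q ^+ 2 = (p.1 - q.1) ^+ 2 + (p.2 - q.2) ^+ 2.
  by rewrite sqr_sqrtr// addr_ge0 ?sqr_ge0.
(* Expanded, Heron's product involves only squares of the sides, which are polynomials in the
   coordinates of the vertices. *)
have heron (l m n : R) : (l + m + n) * (m + n - l) * (n + l - m) * (l + m - n) =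
  2 * (l ^+ 2 * m ^+ 2 + m ^+ 2 * n ^+ 2 + n ^+ 2 * l ^+ 2)
  - (l ^+ 2 * l ^+ 2 + m ^+ 2 * m ^+ 2 + n ^+ 2 * n ^+ 2) by ring.
by rewrite heron !sq /det3; ring.
Qed.

End isominwidth.

(** * Sweeping by parallel chords *)

Section chord_sweep.
Context {R : realType}.
Implicit Types (p q v n : R * R) (D : set (R * R)).

Definition lin n p : R := n.1 * p.1 + n.2 * p.2.

Lemma linD n p q : lin n (p + q) = lin n p + lin n q.
Proof. by rewrite /lin /=; ring. Qed.

Lemma linZ n (t : R) p : lin n (t *: p) = t * lin n p.
Proof. by rewrite /lin /= /GRing.scale/=; ring. Qed.

Lemma lin_continuous n : continuous (lin n).
Proof.
by rewrite (_ : lin n = fun p => n.1 * p.1 + n.2 * p.2 + 0);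
  [exact: continuous_affine2|apply/funext => p; rewrite addr0].
Qed.

Definition segment_path p q (t : R) : R * R := (1 - t) *: p + t *: q.

Lemma polygonal_length_segment p q (s : seq R) : itv_partition 0 1 s ->
  polygonal_length (segment_path p q) s = edist p q.
Proof.
move=> [ps /eqP ls]; rewrite /polygonal_length.
have E (u v : R) : u <= v -> edist ((1 - v) *: p + v *: q) ((1 - u) *: p + u *: q) =
    (v - u) * edist p q.
  move=> uv; rewrite /edist /= /GRing.scale/=.
  rewrite -[v - u in RHS]ger0_norm ?subr_ge0// -sqrtr_sqr -sqrtrM ?sqr_ge0//.
  by congr Num.sqrt; ring.
pose F k := nth 1 (0 :: s) k.
rewrite (eq_big_nat _ _ (F2 := fun k => (F k.+1 - F k) * edist p q)); last first.
  move=> k /andP[_ ks] /=; apply: E; apply/ltW.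
  by have /(pathP 1) := ps => /(_ _ ks).
rewrite -mulr_suml telescope_sumr// /F /= subr0.
have -> : nth 1 (0 :: s) (size s) = last 0 s by rewrite (last_nth 1).
by rewrite ls mul1r.
Qed.

Lemma path_length_segment p q :
  (path_length (segment_path p q) <= (edist p q)%:E)%E.
Proof.
by apply: ge_ereal_sup => _ [s ps <-]; rewrite polygonal_length_segment.
Qed.

(** This shows that a point where a nonzero linear form is extremal on [D], or on a chord of [D], is
    not interior. *)
Lemma interior_push D p v : interior D p -> exists2 e, 0 < e & D (p + e *: v).
Proof.
move=> /nbhs_planeP[e e0 eD].
have v0 : 0 < `|v.1| + `|v.2| + 1 by rewrite ltr_wpDl// addr_ge0.
exists (e / (`|v.1| + `|v.2| + 1)); first by rewrite divr_gt0.
have h (x : R) : `|x| < `|v.1| + `|v.2| + 1 -> `|e / (`|v.1| + `|v.2| + 1) * x| < e.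
  move=> xv; rewrite normrM gtr0_norm ?divr_gt0// mulrAC ltr_pdivrMr//.
  by rewrite ltr_pM2l.
apply: eD; rewrite /= /GRing.scale/= addrAC subrr add0r; apply: h.
  by have := normr_ge0 v.2; lra.
by have := normr_ge0 v.1; lra.
Qed.

(** The homothety of centre [q] and ratio [t] maps a neighbourhood of [p] in [D] to a neighbourhood
    of the combination; [p'] is the preimage of [r]. *)
Lemma interior_comb D p q (t : R) : @convex_set R (R * R)%type D ->
  interior D p -> D q -> 0 < t -> t <= 1 -> interior D (t *: p + (1 - t) *: q).
Proof.
move=> cD /nbhs_planeP[e e0 eD] Dq t0 t1; apply/nbhs_planeP.
exists (t * e); first by rewrite mulr_gt0.
move=> r r1 r2; pose p' := t^-1 *: (r - (1 - t) *: q).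
have -> : r = t *: p' + (1 - t) *: q.
  by rewrite /p' scalerA divff ?gt_eqF// scale1r subrK.
apply: convex_comb => //; first exact: ltW.
have E (x y z : R) : t^-1 * (x - (1 - t) * y) - z = t^-1 * (x - (t * z + (1 - t) * y)).
  by field; rewrite lt0r_neq0.
apply: eD; rewrite /p' /= /GRing.scale/= E normrM gtr0_norm ?invr_gt0//.
  by rewrite ltr_pdivrMl.
by rewrite ltr_pdivrMl.
Qed.

Lemma interior_triangle a b c p : det3 a b c != 0 ->
  0 < bary a b c p -> 0 < bary b c a p -> 0 < bary c a b p -> interior (triangle a b c) p.
Proof.
move=> d0 pa pb pc.
have open_bary (a' b' c' : R * R) : open [set p | 0 < bary a' b' c' p].
  rewrite (_ : [set p | _] = bary a' b' c' @^-1` [set t | 0 < t])//.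
  by apply: open_comp => [q _|]; [exact: bary_continuous|exact: open_gt].
have : nbhs p ([set p | 0 < bary a b c p] `&` [set p | 0 < bary b c a p] `&`
               [set p | 0 < bary c a b p]).
  by apply: open_nbhs_nbhs; split; first by apply: openI; [apply: openI|].
apply: filterS => q [[/= h1 h2] h3]; rewrite triangleE//.
by split; exact: ltW.
Qed.

(** The centroid of a nondegenerate inscribed triangle is interior. *)
Lemma interior_nonempty D : compact D -> @convex_set R (R * R)%type D ->
  (forall x y z : R, (x != 0) || (y != 0) -> ~ (forall p, D p -> x * p.1 + y * p.2 = z)) ->
  exists p, interior D p.
Proof.
move=> cD vD nl.
have [a [b [c [Da Db Dc S0 _]]]] := max_triangle_gt0 cD nl.
have S0' := lt0r_neq0 S0.
exists (3^-1 *: a + 3^-1 *: b + 3^-1 *: c).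
have s3 : 3^-1 + 3^-1 + 3^-1 = 1 :> R by field.
have pos : 0 < 3^-1 :> R by rewrite invr_gt0.
have Sb : det3 b c a != 0 by rewrite det3_rot.
have Sc : det3 c a b != 0 by rewrite det3_rot.
apply: (@interiorS _ (triangle a b c)).
  by move=> p [u [v [w [u0 v0 w0 s ->]]]]; exact: convex_comb3.
by apply: interior_triangle => //; rewrite bary_lin// !bary0l !bary0r !bary1//; lra.
Qed.

Lemma boundaryP D p : closed D -> boundary D p <-> D p /\ ~ interior D p.
Proof. by move=> cD; rewrite /boundary /= /setD/= -(closure_id D).1. Qed.

End chord_sweep.

(** * Continuity of the ends of parallel chords *)

Section chord_ends.
Context {R : realType}.
Implicit Types (p q v n : R * R) (D : set (R * R)).

Lemma within_continuous_dist (A : set R) (f : R -> R) :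
  (forall x, A x -> forall e, 0 < e -> exists2 d, 0 < d &
     forall y, A y -> `|y - x| < d -> `|f y - f x| < e) ->
  {within A, continuous f}.
Proof.
move=> h; apply/subspace_continuousP => x Ax; apply/cvgrPdist_lt => e e0.
have [d d0 hd] := h x Ax e e0.
rewrite near_withinE; apply/nbhs_ballP; exists d => // y xy Ay.
by rewrite distrC; apply: hd => //; rewrite distrC.
Qed.

(** [H c] is the end, in direction [m], of the chord of [D] at level [c]. Its [m]-coordinate is
    upper semicontinuous by compactness and lower semicontinuous by convexity; [P0] and [P1] ensure
    that no level in between is empty. *)
Lemma chord_end D n m c0 c1 P0 P1 : compact D -> @convex_set R (R * R)%type D ->
  D P0 -> D P1 -> lin n P0 = c0 -> lin n P1 = c1 -> c0 < c1 ->
  exists H : R -> R * R, [/\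
    forall c, c0 <= c <= c1 -> D (H c) /\ lin n (H c) = c,
    forall c p, c0 <= c <= c1 -> D p -> lin n p = c -> lin m p <= lin m (H c) &
    {within `[c0, c1], continuous (lin m \o H)}].
Proof.
move=> cD vD D0 D1 n0 n1 c01.
have [H hH] : exists H : R -> R * R, forall c, c0 <= c <= c1 ->
    [/\ D (H c), lin n (H c) = c & forall p, D p -> lin n p = c -> lin m p <= lin m (H c)].
  suff /choice[H hH] : forall c, exists y : R * R, c0 <= c <= c1 ->
    [/\ D y, lin n y = c & forall p, D p -> lin n p = c -> lin m p <= lin m y].
    by exists H.
  move=> c.
  have [cc|/negP cc] := boolP (c0 <= c <= c1); last by exists 0.
  have cDc : compact (D `&` [set p | lin n p = c]).
    apply: compact_closedI => //.
    have -> : [set p | lin n p = c] = lin n @^-1` [set c] by [].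
    by apply: closed_comp => [p _|]; [exact: lin_continuous|exact: closed_eq].
  have Dc0 : (D `&` [set p | lin n p = c]) !=set0.
    exists ((c1 - c) / (c1 - c0) *: P0 + (1 - (c1 - c) / (c1 - c0)) *: P1).
    have d0 : 0 < c1 - c0 by rewrite subr_gt0.
    split; last by rewrite /= linD !linZ n0 n1; field; rewrite gt_eqF.
    apply: convex_comb => //; first by rewrite divr_ge0//; lra.
    by rewrite ler_pdivrMr//; lra.
  have cm : {within D `&` [set p | lin n p = c], continuous (lin m)}.
    by apply: continuous_subspaceT; exact: lin_continuous.
  have [p] := compact_EVT_max Dc0 cDc cm.
  rewrite inE => -[Dp pc] h; exists p => _; split => // q Dq qc.
  by apply: h; rewrite inE.
exists H; split.
- by move=> c /hH[].
- by move=> c p /hH[_ _ h]; exact: h.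
apply: within_continuous_dist => x; rewrite /= in_itv/= => xc e e0.
have [Dx nx hx] := hH x xc.
(* The levels of the points of [D] whose [m]-coordinate is at least [lin m (H x) + e] form a compact
   set that misses [x]. *)
have usc : exists2 d, 0 < d & forall y, c0 <= y <= c1 -> `|y - x| < d ->
    lin m (H y) < lin m (H x) + e.
  pose F := D `&` [set p | lin m (H x) + e <= lin m p].
  have cF : compact F.
    apply: compact_closedI => //.
    have -> : [set p | lin m (H x) + e <= lin m p] =
      lin m @^-1` [set t | lin m (H x) + e <= t] by [].
    by apply: closed_comp => [p _|]; [exact: lin_continuous|exact: closed_ge].
  have cnF : closed (lin n @` F).
    apply: compact_closed; first exact: Rhausdorff.
    apply: continuous_compact => //; apply: continuous_subspaceT; exact: lin_continuous.
  have : nbhs x (~` (lin n @` F)).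
    apply: open_nbhs_nbhs; split; first exact: closed_openC.
    move=> [p [Dp pm] pn]; have := hx p Dp pn; rewrite /= in pm; lra.
  move=> /nbhs_ballP[d d0 hd]; exists d => // y yc yx.
  have [Dy ny hy] := hH y yc.
  rewrite ltNge; apply/negP => h; apply: (hd y); first by rewrite /ball/= distrC.
  by exists (H y).
(* On the segment from [H x] to [H z] the [m]-coordinate varies affinely, and [H] at the same level
   lies at least as far. *)
have lsc z : c0 <= z <= c1 -> z != x -> exists2 d, 0 < d & forall t, 0 <= t <= 1 ->
    `|t * (z - x)| < d -> lin m (H x) - e < lin m (H (x + t * (z - x))).
  move=> zc zx; have [Dz nz _] := hH z zc.
  pose K := `|lin m (H z) - lin m (H x)| + 1.
  have K0 : 0 < K by rewrite ltr_wpDl.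
  have zx0 : 0 < `|z - x| by rewrite normr_gt0 subr_eq0.
  exists (e * `|z - x| / K); first by rewrite divr_gt0// mulr_gt0.
  move=> t /andP[t0 t1]; rewrite normrM (ger0_norm t0) mulrAC ltr_pM2r//.
  rewrite ltr_pdivlMr// => tK.
  have yc : c0 <= x + t * (z - x) <= c1.
    move/andP: xc => [x0 x1]; move/andP: zc => [z0 z1].
    have := mulr_ge0 t0 (_ : 0 <= z - c0); have := mulr_ge0 t0 (_ : 0 <= c1 - z).
    have t1' : 0 <= 1 - t by lra.
    have := mulr_ge0 t1' (_ : 0 <= x - c0); have := mulr_ge0 t1' (_ : 0 <= c1 - x).
    rewrite !subr_ge0 => /(_ x1) a1 /(_ x0) a2 /(_ z1) a3 /(_ z0) a4.
    by apply/andP; split; nra.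
  have [_ _ hy] := hH _ yc.
  have := hy (t *: H z + (1 - t) *: H x).
  rewrite !linD !linZ nz nx => /(_ (convex_comb vD t0 t1 Dz Dx)).
  rewrite (_ : t * z + (1 - t) * x = x + t * (z - x)); last by ring.
  move=> /(_ erefl); apply: lt_le_trans.
  have : `|t * (lin m (H z) - lin m (H x))| < e.
    apply: le_lt_trans tK; rewrite normrM (ger0_norm t0) ler_wpM2l//.
    by rewrite /K lerDl.
  by rewrite ltr_norml => /andP[h1 h2]; nra.
have lsc' z : c0 <= z <= c1 -> exists2 d, 0 < d & forall t, 0 <= t <= 1 ->
    `|t * (z - x)| < d -> lin m (H x) - e < lin m (H (x + t * (z - x))).
  move=> zc; have [->|zx] := eqVneq z x; last exact: lsc.
  by exists 1 => // t _ _; rewrite subrr mulr0 addr0; lra.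
have [d1 d10 h1] := usc.
have [|d2 d20 h2] := lsc' c0; first by rewrite lexx ltW.
have [|d3 d30 h3] := lsc' c1; first by rewrite lexx ltW.
exists (Num.min d1 (Num.min d2 d3)); first by rewrite !lt_min d10 d20 d30.
move=> y; rewrite /= in_itv/= => yc; rewrite !lt_min => /and3P[yd1 yd2 yd3].
rewrite ltr_norml; apply/andP; split; last by have := h1 y yc yd1; lra.
suff : lin m (H x) - e < lin m (H y) by lra.
move/andP: (xc) => [x0 x1]; move/andP: (yc) => [y0 y1].
(* A level near [x] lies between [x] and [c0] or between [x] and [c1], so two segments are
   enough. *)
have [yx|xy] := leP y x.
- have [c0x|xc0] := eqVneq c0 x.
    by have -> : y = x; [lra|lra].
  have xc0' : c0 - x != 0 by rewrite subr_eq0.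
  have yE : y = x + (y - x) / (c0 - x) * (c0 - x) by rewrite divfK// addrC subrK.
  rewrite yE; apply: h2; last by rewrite divfK.
  have c0x' : c0 - x < 0 by rewrite lt_neqAle xc0'/=; lra.
  by rewrite ler_ndivlMr// ler_ndivrMr//; apply/andP; split; lra.
- have xc1' : 0 < c1 - x by lra.
  have yE : y = x + (y - x) / (c1 - x) * (c1 - x) by rewrite divfK ?gt_eqF// addrC subrK.
  rewrite yE; apply: h3; last by rewrite divfK// gt_eqF.
  by rewrite ler_pdivlMr// ler_pdivrMr//; apply/andP; split; lra.
Qed.

End chord_ends.

Section parallel_chords.
Context {R : realType}.
Implicit Types (p q v n : R * R) (D : set (R * R)).

Definition perp n : R * R := (- n.2, n.1).

Lemma lin_perp n : lin n (perp n) = 0.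
Proof. by rewrite /lin /perp /=; ring. Qed.

Lemma lin_inj n p q : n != 0 -> lin n p = lin n q -> lin (perp n) p = lin (perp n) q -> p = q.
Proof.
move=> n0; rewrite /lin /perp /= => h1 h2.
have r0 : n.1 ^+ 2 + n.2 ^+ 2 != 0.
  apply: contra n0; rewrite paddr_eq0 ?sqr_ge0// !sqrf_eq0 => /andP[/eqP a /eqP b].
  by apply/eqP; rewrite [LHS]surjective_pairing a b.
have E1 v : (n.1 ^+ 2 + n.2 ^+ 2) * v.1 =
    n.1 * (n.1 * v.1 + n.2 * v.2) - n.2 * (- n.2 * v.1 + n.1 * v.2) by ring.
have E2 v : (n.1 ^+ 2 + n.2 ^+ 2) * v.2 =
    n.2 * (n.1 * v.1 + n.2 * v.2) + n.1 * (- n.2 * v.1 + n.1 * v.2) by ring.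
rewrite [LHS]surjective_pairing [RHS]surjective_pairing; congr pair; apply: (mulfI r0).
  by rewrite !E1 h1 h2.
by rewrite !E2 h1 h2.
Qed.

Lemma lin_perp_gt0 n : n != 0 -> 0 < lin (perp n) (perp n).
Proof.
move=> n0; rewrite /lin /perp /= mulrNN -!expr2 lt_neqAle addr_ge0 ?sqr_ge0// andbT eq_sym.
apply: contra n0; rewrite paddr_eq0 ?sqr_ge0// !sqrf_eq0 => /andP[/eqP a /eqP b].
by apply/eqP; rewrite [LHS]surjective_pairing a b.
Qed.

Lemma within_continuous_lin (T : topologicalType) (S : set T) (f : T -> R * R) n :
  n != 0 -> {within S, continuous (lin n \o f)} ->
  {within S, continuous (lin (perp n) \o f)} -> {within S, continuous f}.
Proof.
move=> n0 /subspace_continuousP cn /subspace_continuousP cm.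
have r0 := lt0r_neq0 (lin_perp_gt0 n0); set r := lin (perp n) (perp n) in r0.
pose f1 x := n.1 / r * lin n (f x) - n.2 / r * lin (perp n) (f x).
pose f2 x := n.2 / r * lin n (f x) + n.1 / r * lin (perp n) (f x).
have -> : f = fun x => (f1 x, f2 x).
  apply/funext => x; rewrite [LHS]surjective_pairing; congr pair; apply: (mulfI r0);
    rewrite /f1 /f2 /r /lin /perp /= in r0 *; by field.
apply/subspace_continuousP => x Sx.
have c1 : f1 @ within S (nbhs x) --> f1 x.
  by apply: cvgB; apply: cvgMr; [exact: cn|exact: cm].
have c2 : f2 @ within S (nbhs x) --> f2 x.
  by apply: cvgD; apply: cvgMr; [exact: cn|exact: cm].
exact: cvg_pair c1 c2.
Qed.

Section sweep.
(** [P] and [Q] are the only points of [D] at the extreme levels of [lin n], so the first and the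
    last chord are points; [K] bounds all chord lengths. *)
Variables (D : set (R * R)) (n P Q : R * R) (K : R).
Hypotheses (cD : compact D) (vD : @convex_set R (R * R)%type D)
  (intD : exists p, interior D p) (n0 : n != 0) (DP : D P) (DQ : D Q)
  (Pmax : forall p, D p -> p != P -> lin n p < lin n P)
  (Qmin : forall p, D p -> p != Q -> lin n Q < lin n p)
  (chordK : forall p q, D p -> D q -> lin n p = lin n q -> edist p q <= K).
Local Notation m := (perp n).
Local Notation c0 := (lin n Q).
Local Notation c1 := (lin n P).

Let level_bound p : D p -> c0 <= lin n p <= c1.
Proof.
move=> Dp; apply/andP; split.
  by have [->|pQ] := eqVneq p Q => //; exact/ltW/Qmin.
by have [->|pP] := eqVneq p P => //; exact/ltW/Pmax.
Qed.

Let c01 : c0 < c1.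
Proof.
have [z iz] := intD; have [e e0 De] := interior_push n iz.
have Dz : D z := interior_subset iz.
rewrite ltNge; apply/negP => c10.
have := level_bound De; have := level_bound Dz; rewrite linD linZ => /andP[h1 h2] /andP[h3 h4].
have nn : 0 < lin n n by have := lin_perp_gt0 n0; rewrite /lin /perp/=; lra.
by have := mulr_gt0 e0 nn; lra.
Qed.

(** The segments from an interior point to [Q] and to [P] cross all levels strictly between the
    extremes, at interior points. *)
Let interior_level c : c0 < c < c1 -> exists2 z, interior D z & lin n z = c.
Proof.
move=> /andP[cc0 cc1]; have [z iz] := intD.
have Dz : D z := interior_subset iz.
have /andP[z0 z1] := level_bound Dz.
have [cz|zc] := leP c (lin n z).
  have d0 : 0 < lin n z - c0 by lra.
  exists ((c - c0) / (lin n z - c0) *: z + (1 - (c - c0) / (lin n z - c0)) *: Q).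
    apply: interior_comb => //; first by rewrite divr_gt0//; lra.
    by rewrite ler_pdivrMr//; lra.
  by rewrite linD !linZ; field; rewrite gt_eqF.
have d0 : 0 < c1 - lin n z by lra.
exists ((c1 - c) / (c1 - lin n z) *: z + (1 - (c1 - c) / (c1 - lin n z)) *: P).
  apply: interior_comb => //; first by rewrite divr_gt0//; lra.
  by rewrite ler_pdivrMr//; lra.
by rewrite linD !linZ; field; rewrite gt_eqF.
Qed.

Let m0 : 0 < lin m m := lin_perp_gt0 n0.

(** The chord at time [t] has level [lev t], which runs from the lowest to the highest level of [D].
    The level of an evader minus [lev] is nonnegative at time [0] and nonpositive at time [1]; at a
    zero the evader is on the chord. *)
Lemma parallel_sweep : (sweeping_cost D <= K%:E)%E.
Proof.
have closedD := compact_plane_closed cD.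
have [hi [hiD himax hic]] := chord_end m cD vD DQ DP erefl erefl c01.
(* The lower end of a chord is its upper end for the reversed direction. *)
have [lo [loD lomin loc]] := chord_end (- m) cD vD DQ DP erefl erefl c01.
have linN p : lin (- m) p = - lin m p by rewrite /lin/=; ring.
pose lev (t : R) := (1 - t) * c0 + t * c1.
have lev01 t : 0 <= t <= 1 -> c0 <= lev t <= c1.
  move=> /andP[t0 t1]; have c10 : 0 <= c1 - c0 by rewrite subr_ge0 ltW.
  have := mulr_ge0 t0 c10; have : 0 <= (1 - t) * (c1 - c0) by rewrite mulr_ge0// subr_ge0.
  move=> h1 h2; rewrite /lev; apply/andP; split; lra.
have lev_oo t : 0 < t < 1 -> c0 < lev t < c1.
  move=> /andP[t0 t1]; have c10 : 0 < c1 - c0 by rewrite subr_gt0.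
  have := mulr_gt0 t0 c10; have : 0 < (1 - t) * (c1 - c0) by rewrite mulr_gt0// subr_gt0.
  move=> h1 h2; rewrite /lev; apply/andP; split; lra.
pose f (x : R * R) : R * R := (1 - x.1) *: lo (lev x.2) + x.1 *: hi (lev x.2).
have fD s t : 0 <= s <= 1 -> 0 <= t <= 1 -> D (f (s, t)).
  move=> /andP[s0 s1] /lev01 ht; rewrite /f/= addrC.
  by apply: convex_comb => //; [exact: (hiD _ ht).1|exact: (loD _ ht).1].
have fn s t : 0 <= t <= 1 -> lin n (f (s, t)) = lev t.
  move=> /lev01 ht; rewrite /f /= linD !linZ (hiD _ ht).2 (loD _ ht).2; ring.
have fm s t : lin m (f (s, t)) = (1 - s) * lin m (lo (lev t)) + s * lin m (hi (lev t)).
  by rewrite /f /= linD !linZ.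
(* Pushing an interior point along [m] or [- m] keeps its level, so it lies strictly between the
   ends of its chord. Hence the ends are boundary points, and the intermediate chords are
   nondegenerate. *)
have lo_lt_int t z : 0 <= t <= 1 -> interior D z -> lin n z = lev t ->
    lin m (lo (lev t)) < lin m z < lin m (hi (lev t)).
  move=> /lev01 ht iz zt.
  have [e e0 De] := interior_push m iz; have [e' e'0 De'] := interior_push (- m) iz.
  have := himax _ _ ht De; rewrite linD linZ lin_perp mulr0 addr0 => /(_ zt).
  have := lomin _ _ ht De'; rewrite linD linZ.
  have -> : lin n (- m) = 0 by rewrite /lin/perp/=; ring.
  rewrite mulr0 addr0 => /(_ zt); rewrite !linN !linD !linZ.
  have -> : lin m (- m) = - lin m m by rewrite /lin/=; ring.
  by have := mulr_gt0 e0 m0; have := mulr_gt0 e'0 m0; move=> h1 h2 h3 h4; apply/andP; split; lra.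
have lohi t : 0 < t < 1 -> lin m (lo (lev t)) < lin m (hi (lev t)).
  move=> t01; have [z iz zt] := interior_level (lev_oo _ t01).
  have t01' : 0 <= t <= 1 by move/andP: t01 => [? ?]; rewrite !ltW.
  by have /andP[h1 h2] := lo_lt_int _ _ t01' iz zt; exact: lt_trans h2.
have lo_bd t : 0 <= t <= 1 -> boundary D (lo (lev t)).
  move=> t01; have ht := lev01 _ t01; apply/(boundaryP _ closedD); split; first exact: (loD _ ht).1.
  by move=> /(lo_lt_int t) => /(_ t01 (loD _ ht).2) /andP[]; rewrite ltxx.
have hi_bd t : 0 <= t <= 1 -> boundary D (hi (lev t)).
  move=> t01; have ht := lev01 _ t01; apply/(boundaryP _ closedD); split; first exact: (hiD _ ht).1.
  by move=> /(lo_lt_int t) => /(_ t01 (hiD _ ht).2) /andP[_]; rewrite ltxx.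
have i0 : 0 <= (0 : R) <= 1 by rewrite lexx ler01.
have i1 : 0 <= (1 : R) <= 1 by rewrite lexx ler01.
have atQ p : D p -> lin n p = lev 0 -> p = Q.
  move=> Dp pn; apply/eqP; apply: contraT => /(Qmin Dp).
  by rewrite pn /lev subr0 mul1r mul0r addr0 ltxx.
have atP p : D p -> lin n p = lev 1 -> p = P.
  move=> Dp pn; apply/eqP; apply: contraT => /(Pmax Dp).
  by rewrite pn /lev subrr mul1r mul0r add0r ltxx.
have f0 s : 0 <= s <= 1 -> f (s, 0) = Q by move=> s01; apply: atQ; [exact: fD|exact: fn].
have f1 s : 0 <= s <= 1 -> f (s, 1) = P by move=> s01; apply: atP; [exact: fD|exact: fn].
have bdQ : boundary D Q.
  by rewrite -(atQ (lo (lev 0))); [exact: lo_bd|exact: (loD _ (lev01 _ i0)).1|exact: (loD _ (lev01 _ i0)).2].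
have bdP : boundary D P.
  by rewrite -(atP (lo (lev 1))); [exact: lo_bd|exact: (loD _ (lev01 _ i1)).1|exact: (loD _ (lev01 _ i1)).2].
(* A point of an intermediate chord strictly between its ends is a combination, with positive weight
   on [z], of one end and an interior point [z] of the same level. *)
have fint s t : 0 < s < 1 -> 0 < t < 1 -> interior D (f (s, t)).
  move=> /andP[s0 s1] t01; have [z iz zt] := interior_level (lev_oo _ t01).
  have t01' : 0 <= t <= 1 by move/andP: t01 => [? ?]; rewrite !ltW.
  have /andP[h1 h2] := lo_lt_int _ _ t01' iz zt.
  have ht := lev01 _ t01'.
  have hl : 0 < lin m (hi (lev t)) - lin m (lo (lev t)) by lra.
  have s0' := mulr_gt0 s0 hl.
  have s1' : 0 < (1 - s) * (lin m (hi (lev t)) - lin m (lo (lev t))).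
    by rewrite mulr_gt0// subr_gt0.
  have [fz|zf] := leP (lin m (f (s, t))) (lin m z).
    have d0 : 0 < lin m z - lin m (lo (lev t)) by lra.
    pose l := (lin m (f (s, t)) - lin m (lo (lev t))) / (lin m z - lin m (lo (lev t))).
    have -> : f (s, t) = l *: z + (1 - l) *: lo (lev t).
      apply: (lin_inj n0); first by rewrite fn// linD !linZ zt (loD _ ht).2; ring.
      by rewrite [RHS]linD !linZ /l; field; rewrite gt_eqF.
    apply: interior_comb => //; first exact: (loD _ ht).1.
      by rewrite divr_gt0// fm; lra.
    by rewrite ler_pdivrMr//; lra.
  have d0 : 0 < lin m (hi (lev t)) - lin m z by lra.
  pose l := (lin m (hi (lev t)) - lin m (f (s, t))) / (lin m (hi (lev t)) - lin m z).
  have -> : f (s, t) = l *: z + (1 - l) *: hi (lev t).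
    apply: (lin_inj n0); first by rewrite fn// linD !linZ zt (hiD _ ht).2; ring.
    by rewrite [RHS]linD !linZ /l; field; rewrite gt_eqF.
  apply: interior_comb => //; first exact: (hiD _ ht).1.
    by rewrite divr_gt0// fm; lra.
  by rewrite ler_pdivrMr//; lra.
have fseg t : (fun s => f (s, t)) = segment_path (lo (lev t)) (hi (lev t)) by [].
have flen t : 0 <= t <= 1 -> (path_length (fun s => f (s, t)) <= K%:E)%E.
  move=> t01; have ht := lev01 _ t01; rewrite fseg.
  apply: (le_trans (path_length_segment _ _)); rewrite lee_fin; apply: chordK.
  - exact: (loD _ ht).1.
  - exact: (hiD _ ht).1.
  - by rewrite (hiD _ ht).2 (loD _ ht).2.
have clev : continuous lev.
  move=> t; apply: cvgD; apply: cvgMl; last exact: cvg_id.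
  by apply: cvgB; [exact: cvg_cst|exact: cvg_id].
have cf : {within `[0, 1] `*` `[0, 1], continuous f}.
  pose S : set (R * R) := `[0, 1] `*` `[0, 1].
  have clev2 : {within S, continuous (lev \o snd)}.
    apply: continuous_subspaceT => x.
    by apply: continuous_comp; [exact: continuous_snd2|exact: clev].
  have lev2 : (lev \o snd) @` S `<=` `[c0, c1].
    by move=> _ [[s t] [/= _ t01] <-]; move: t01; rewrite !in_itv/=; exact: lev01.
  have /subspace_continuousP chi := within_continuous_comp2 hic clev2 lev2.
  have /subspace_continuousP clo := within_continuous_comp2 loc clev2 lev2.
  (* Continuity is checked on the two coordinates: the level, and the interpolation between the
     [m]-coordinates of the ends, the only quantities of [lo] and [hi] known to be continuous. *)
  apply: (within_continuous_lin n0).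
    apply: subspace_eq_continuous clev2 => -[s t]; rewrite inE /S /= !in_itv/= => -[s01 t01].
    by rewrite [RHS]fn.
  apply/subspace_continuousP => x Sx.
  rewrite (_ : lin m \o f = fun x => (1 - x.1) * - (lin (- m) \o lo \o (lev \o snd)) x +
                       x.1 * (lin m \o hi \o (lev \o snd)) x); last first.
    by apply/funext => -[s t]; rewrite [LHS]fm /= linN opprK.
  have cx1 : fst @ within S (nbhs x) --> x.1.
    by apply: cvg_within_filter; exact: continuous_fst2.
  apply: cvgD; apply: cvgM => //; last exact: chi.
    by apply: cvgB => //; exact: cvg_cst.
  by apply: cvgN; exact: clo.
have sf : sensor_curve D f.
  split => //.
  - move=> t; rewrite in_itv/= => /andP[t0 t1]; apply: le_lt_trans (ltry K).
    by apply: flen; rewrite !ltW.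
  - move=> t; rewrite in_itv/= => t01 s s' _ _ /(congr1 (lin m)); rewrite !fm => h.
    have hl := lohi _ t01; apply/eqP; rewrite -subr_eq0.
    have hl0 : lin m (hi (lev t)) - lin m (lo (lev t)) != 0 by rewrite gt_eqF// subr_gt0.
    by rewrite -(mulIr_eq0 _ (mulIf hl0)); apply/eqP; lra.
  - by exists Q => // s; rewrite in_itv/=; exact: f0.
  - by exists P => // s; rewrite in_itv/=; exact: f1.
  - move=> s t; rewrite !in_itv/= => s01 t01; split.
      move=> /(boundaryP _ closedD)[_ nint]; apply: contrapT => h; apply: nint.
      move/andP: s01 => [s0 s1]; move/andP: t01 => [t0 t1].
      apply: fint; rewrite !lt_neqAle ?s0 ?s1 ?t0 ?t1 !andbT; apply/andP; split; apply/eqP => E;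
        apply: h; first [by constructor 1|by constructor 2|by constructor 3|by constructor 4].
    move=> [-> | -> | -> | ->].
    + by rewrite /f/= subr0 scale1r scale0r addr0; exact: lo_bd.
    + by rewrite /f/= subrr scale1r scale0r add0r; exact: hi_bd.
    + by rewrite f0.
    + by rewrite f1.
apply: (@le_trans _ _ (sensor_length f)).
  apply: ereal_inf_lbound; exists f => //; split => // g cg gD.
  have ck : {within `[0, 1], continuous (fun t => lin n (g t) - lev t)}.
    apply: within_continuousB; last exact: continuous_subspaceT.
    by apply: within_continuous_comp cg => p _; exact: lin_continuous.
  have kr : Num.min (lin n (g 0) - lev 0) (lin n (g 1) - lev 1) <= 0 <=
            Num.max (lin n (g 0) - lev 0) (lin n (g 1) - lev 1).
    have Dg0 : D (g 0) by apply: gD; rewrite in_itv.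
    have Dg1 : D (g 1) by apply: gD; rewrite in_itv.
    have /andP[h1 _] := level_bound Dg0; have /andP[_ h2] := level_bound Dg1.
    by rewrite ge_min le_max /lev; apply/andP; split; apply/orP; [right|left]; lra.
  have [t t01 kt] := IVT ler01 ck kr; exists t => //.
  rewrite in_itv/= in t01.
  have gt : lin n (g t) = lev t by lra.
  have ht := lev01 _ t01; have Dg : D (g t) by apply: gD; rewrite in_itv.
  have h1 := himax _ _ ht Dg gt; have := lomin _ _ ht Dg gt; rewrite !linN lerN2 => h2.
  (* If the chord is a single point, any parameter will do, for instance [0]. *)
  have [h12|h12] := eqVneq (lin m (lo (lev t))) (lin m (hi (lev t))).
    exists 0; first by rewrite in_itv.
    apply: (lin_inj n0); first by rewrite fn.
    by rewrite fm; lra.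
  have d0 : 0 < lin m (hi (lev t)) - lin m (lo (lev t)).
    by rewrite subr_gt0 lt_neqAle h12; lra.
  exists ((lin m (g t) - lin m (lo (lev t))) / (lin m (hi (lev t)) - lin m (lo (lev t)))).
    rewrite in_itv/=; apply/andP; split; first by rewrite divr_ge0//; lra.
    by rewrite ler_pdivrMr//; lra.
  apply: (lin_inj n0); first by rewrite fn.
  by rewrite fm; field; rewrite gt_eqF.
apply: ge_ereal_sup => _ [t + <-]; rewrite /= in_itv/=; exact: flen.
Qed.

End sweep.
End parallel_chords.

(** * The sweeping cost is at most the width of a strip *)

Section strip.
Context {R : realType}.
Implicit Types (p q v n : R * R) (D : set (R * R)).

(* Tilting the chords by a slope [k] makes the first and the last one degenerate to a
   point: for a pair [P], [Q] of maximal distance in the Euclidean norm with square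
   [t * lin (perp n) v ^+ 2 + lin n v ^+ 2], the inner product with [P - Q] has a
   unique maximum and a unique minimum on [D]; and [k] tends to [0] as [t] grows. *)
Lemma sweeping_cost_strip D n lo hi : compact D -> @convex_set R (R * R)%type D ->
  (exists p, interior D p) -> n != 0 -> (forall p, D p -> lo <= lin n p <= hi) ->
  (sweeping_cost D <= ((hi - lo) / Num.sqrt (n.1 ^+ 2 + n.2 ^+ 2))%:E)%E.
Proof.
move=> cD vD iD n0 strip; set W := hi - lo; set r := n.1 ^+ 2 + n.2 ^+ 2.
have rE : r = lin (perp n) (perp n) by rewrite /r /lin/=; ring.
have r0 : 0 < r by rewrite rE lin_perp_gt0.
have sr0 : 0 < Num.sqrt r by rewrite sqrtr_gt0.
have srr : Num.sqrt r ^+ 2 = r by rewrite sqr_sqrtr// ltW.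
have [z iz] := iD; have Dz : D z := interior_subset iz.
have [e e0 De] := interior_push (perp n) iz.
have [e' e'0 De'] := interior_push n iz.
(* [E] is the extent, under [lin (perp n)], of a segment in [D] parallel to the untilted chords. *)
pose E := e * r.
have E0 : 0 < E by rewrite mulr_gt0.
have W0 : 0 < W.
  have /andP[_ h1] := strip _ De'; have /andP[h2 _] := strip _ Dz.
  have nn : lin n n = r by rewrite /lin /r; ring.
  rewrite linD linZ nn in h1; have := mulr_gt0 e'0 r0; rewrite /W; lra.
apply/lee_addgt0Pr => eps eps0; rewrite -EFinD.
(* The first term ensures that [P - Q] has a component along [perp n] comparable to [E]; the second
   makes the tilt small enough to cost at most [eps]. *)
pose t := 2 * W ^+ 2 / E ^+ 2 + 2 * W ^+ 2 / (E * eps * Num.sqrt r).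
have t1 : 0 < 2 * W ^+ 2 / E ^+ 2 by rewrite divr_gt0// ?mulr_gt0// exprn_gt0.
have t2 : 0 < 2 * W ^+ 2 / (E * eps * Num.sqrt r) by rewrite divr_gt0// ?mulr_gt0// exprn_gt0.
have t0 : 0 < t by rewrite addr_gt0.
have tE : 2 * W ^+ 2 <= t * E ^+ 2.
  by rewrite -ler_pdivrMr ?exprn_gt0// /t lerDl ltW.
have teps : 2 * W ^+ 2 <= t * (E * eps * Num.sqrt r).
  by rewrite -ler_pdivrMr ?mulr_gt0// /t lerDr ltW.
(* The inner product of the stretched norm, whose farthest pair in [D] is [P], [Q]. *)
pose B p q : R := t * (lin (perp n) p * lin (perp n) q) + lin n p * lin n q.
have B0 p q : p != q -> 0 < B (p - q) (p - q).
  move=> pq; rewrite /B -!expr2.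
  have h1 : 0 <= t * lin (perp n) (p - q) ^+ 2 by rewrite mulr_ge0 ?sqr_ge0// ltW.
  have h2 := sqr_ge0 (lin n (p - q)).
  rewrite lt_neqAle addr_ge0// andbT eq_sym; apply: contra pq; rewrite paddr_eq0//.
  rewrite mulf_eq0 gt_eqF//= !sqrf_eq0 => /andP[/eqP h3 /eqP h4].
  by apply/eqP; apply: (lin_inj n0); [move: h4|move: h3]; rewrite /lin/=; lra.
have [P [Q [DP DQ PQ0 PQmax]]] : exists P Q, [/\ D P, D Q, 0 <= lin (perp n) (P - Q) &
    forall p q, D p -> D q -> B (p - q) (p - q) <= B (P - Q) (P - Q)].
  have cBf : continuous (fun x : (R * R) * (R * R) => B (x.1 - x.2) (x.1 - x.2)).
    have cl k : continuous (fun x : (R * R) * (R * R) => lin k (x.1 - x.2)).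
      move=> x; apply: (@continuous_comp _ _ _ (fun x : (R * R) * (R * R) => x.1 - x.2) (lin k)).
        by apply: cvgB; [exact: cvg_fst|exact: cvg_snd].
      exact: lin_continuous.
    move=> x; apply: cvgD; last by apply: cvgM; exact: cl.
    by apply: cvgMr; apply: cvgM; exact: cl.
  have D2 : D `*` D !=set0 by exists (z, z).
  have cBw : {within D `*` D, continuous (fun x : (R * R) * (R * R) => B (x.1 - x.2) (x.1 - x.2))}.
    exact: continuous_subspaceT.
  have [[P Q]] := compact_EVT_max D2 (compact_setX cD cD) cBw.
  rewrite inE => -[/= DP DQ] h.
  have h' p q : D p -> D q -> B (p - q) (p - q) <= B (P - Q) (P - Q).
    by move=> Dp Dq; apply: (h (p, q)); rewrite inE.
  (* Exchanging [P] and [Q] fixes the sign of the component along [perp n]. *)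
  have [PQ0|PQ0] := leP 0 (lin (perp n) (P - Q)); first by exists P, Q.
  exists Q, P; split => //.
    by move: PQ0; rewrite /lin/=; lra.
  move=> p q Dp Dq; apply: (le_trans (h' p q Dp Dq)).
  by rewrite le_eqVlt; apply/orP; left; apply/eqP; rewrite /B /lin/=; ring.
set a := lin (perp n) (P - Q) in PQ0; pose b := lin n (P - Q).
have linB k p q : lin k (p - q) = lin k p - lin k q by rewrite /lin/=; ring.
have bW p q : D p -> D q -> lin n (p - q) ^+ 2 <= W ^+ 2.
  move=> /strip/andP[h1 h2] /strip/andP[h3 h4]; rewrite linB /W.
  have : 0 <= (hi - lo - (lin n p - lin n q)) * (hi - lo + (lin n p - lin n q)).
    by rewrite mulr_ge0//; lra.
  by move=> h; nra.
(* Comparing [P], [Q] with the segment of extent [E] gives [t E^2 <= t a^2 + W^2], and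
   [2 W^2 <= t E^2] by the choice of [t]. *)
have a_ge : E ^+ 2 <= 2 * a ^+ 2.
  have := PQmax _ _ De Dz; rewrite {2}/B -!expr2 -/a -/b.
  rewrite (_ : z + e *: perp n - z = e *: perp n); last by rewrite addrAC subrr add0r.
  rewrite /B -!expr2 !linZ -rE -/E lin_perp mulr0 expr0n/= addr0 => h1.
  have h2 := bW P Q DP DQ; rewrite -/b in h2.
  rewrite -(ler_pM2l t0); lra.
have a0 : 0 < a.
  rewrite lt_neqAle PQ0 andbT eq_sym; apply/eqP => a0.
  by move: a_ge; rewrite a0 expr0n/= mulr0 leNgt exprn_gt0.
have aE : E <= 2 * a.
  have Ege := ltW E0; have a2ge : 0 <= 2 * a by rewrite mulr_ge0.
  rewrite -(@ler_pXn2r _ 2)// ?nnegrE//.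
  by rewrite [leRHS]exprMn; have := sqr_ge0 a; lra.
(* With this slope, [lin l] is a positive multiple of the [B]-inner product with [P - Q]. *)
pose k := b / (t * a).
have ta0 : 0 < t * a by rewrite mulr_gt0.
pose l := perp n + k *: n.
have linl p : lin l p = lin (perp n) p + k * lin n p.
  by rewrite /l /lin/= /GRing.scale/=; ring.
have BE p : t * a * lin l p = B (P - Q) p.
  by rewrite linl /B -/a -/b /k; field; rewrite !lt0r_neq0.
have sub_add p q v : B (p - q) (p - q) =
   B (p - v) (p - v) + 2 * B (v - q) (p - v) + B (v - q) (v - q).
  by rewrite /B !linB; ring.
(* Were [p] at least as high as [P], then [p - Q] would be strictly longer than [P - Q]: its square
   gains a nonnegative cross term and the positive square of [p - P]. *)
have Pmax p : D p -> p != P -> lin l p < lin l P.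
  move=> Dp pP; rewrite -(ltr_pM2l ta0) !BE ltNge; apply/negP => h.
  have := PQmax _ _ Dp DQ; rewrite (sub_add p Q P).
  have := B0 _ _ pP; have : B (P - Q) (p - P) = B (P - Q) p - B (P - Q) P.
    by rewrite /B !linB; ring.
  lra.
have Qmin p : D p -> p != Q -> lin l Q < lin l p.
  move=> Dp pQ; rewrite -(ltr_pM2l ta0) !BE ltNge; apply/negP => h.
  have := PQmax _ _ DP Dp.
  have -> : B (P - p) (P - p) = B (p - Q) (p - Q) - 2 * (B (P - Q) p - B (P - Q) Q) +
      B (P - Q) (P - Q) by rewrite /B !linB; ring.
  have := B0 _ _ pQ; lra.
have l0 : l != 0.
  apply/eqP => l0; have PQ : P != Q.
    by apply/eqP => PQ; move: a0; rewrite /a PQ linB subrr ltxx.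
  by have := Qmin _ DP PQ; rewrite l0 /lin /= !mul0r ltxx.
have k_le : W * `|k| <= eps * Num.sqrt r.
  have bW' : `|b| <= W.
    have Wge := ltW W0.
    by rewrite -(@ler_pXn2r _ 2)// ?nnegrE// real_normK ?num_real//; exact: bW.
  rewrite /k normrM normfV (gtr0_norm ta0) mulrA ler_pdivrMr//.
  have h1 : W * `|b| <= W ^+ 2 by rewrite expr2 ler_wpM2l// ltW.
  have h2 : t * eps * Num.sqrt r * E <= t * eps * Num.sqrt r * (2 * a).
    by rewrite ler_wpM2l// !mulr_ge0// ltW.
  lra.
apply: (parallel_sweep cD vD iD l0 DP DQ Pmax Qmin) => p q Dp Dq; rewrite !linl => pq.
have -> : W / Num.sqrt r + eps = (W + eps * Num.sqrt r) / Num.sqrt r.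
  by field; rewrite gt_eqF.
rewrite ler_pdivlMr// /edist -sqrtrM ?addr_ge0 ?sqr_ge0//.
apply: (@le_trans _ _ (W + W * `|k|)); last by rewrite lerD2l.
have WK : 0 <= W + W * `|k| by rewrite addr_ge0 ?mulr_ge0// ltW.
rewrite -(ger0_norm WK) -sqrtr_sqr ler_sqrt ?sqr_ge0//.
have -> : ((p.1 - q.1) ^+ 2 + (p.2 - q.2) ^+ 2) * r =
   lin n (p - q) ^+ 2 + lin (perp n) (p - q) ^+ 2 by rewrite /r /lin /=; ring.
(* On a tilted chord the component along [perp n] is [- k] times the one along [n], which is at most
   [W] in absolute value; so the length exceeds that of an untilted chord bound by a factor of at
   most [1 + |k|]. *)
have -> : lin (perp n) (p - q) = - (k * lin n (p - q)) by rewrite !linB; lra.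
rewrite sqrrN exprMn -[X in X + _]mul1r -mulrDl.
have k2 : k ^+ 2 = `|k| ^+ 2 by rewrite real_normK// num_real.
apply: (@le_trans _ _ ((1 + `|k|) ^+ 2 * W ^+ 2)).
  apply: ler_pM; [by rewrite addr_ge0// sqr_ge0|exact: sqr_ge0| |exact: bW].
  by rewrite k2; have := normr_ge0 k; nra.
by rewrite -exprMn (_ : (1 + `|k|) * W = W + W * `|k|)//; ring.
Qed.

End strip.

(** * Equilateral triangles *)

Section triangle_sweep.
Context {R : realType}.
Implicit Types (a b c p q v n : R * R) (D : set (R * R)).

Lemma triangle_rot a b c : triangle b c a = triangle a b c.
Proof.
apply/seteqP; split => p [u [v [w [u0 v0 w0 s ->]]]].
  by exists w, u, v; split => //; [lra|rewrite [RHS]addrC addrA -addrA addrC -addrA addrC -!addrA].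
by exists v, w, u; split => //; [lra|rewrite -addrA addrC].
Qed.

Lemma edist_ge0 p q : 0 <= edist p q.
Proof. exact: sqrtr_ge0. Qed.

Lemma edist_sqr p q : edist p q ^+ 2 = (p.1 - q.1) ^+ 2 + (p.2 - q.2) ^+ 2.
Proof. by rewrite sqr_sqrtr// addr_ge0 ?sqr_ge0. Qed.

(** By the Cauchy-Schwarz inequality, since [bary] times the determinant has a gradient of the
    length of [b c]. The defect of the squares is the square of the inner product of [b - c] and
    [p - q]. *)
Lemma bary_lipschitz a b c p q :
  `|bary a b c p - bary a b c q| * `|det3 a b c| <= edist b c * edist p q.
Proof.
have [d0|d0] := eqVneq (det3 a b c) 0.
  by rewrite d0 normr0 mulr0 mulr_ge0 ?edist_ge0.
rewrite -normrM mulrBl !divfK// -(@ler_pXn2r _ 2)// ?nnegrE ?mulr_ge0 ?edist_ge0//.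
rewrite real_normK ?num_real// exprMn !edist_sqr -subr_ge0.
rewrite (_ : _ - _ = ((b.1 - c.1) * (p.1 - q.1) + (b.2 - c.2) * (p.2 - q.2)) ^+ 2).
  exact: sqr_ge0.
by rewrite /det3; ring.
Qed.

Lemma closed_triangle a b c : det3 a b c != 0 -> closed (triangle a b c).
Proof.
move=> d0; rewrite triangleE//.
have closed_bary (a' b' c' : R * R) : closed [set p | 0 <= bary a' b' c' p].
  rewrite (_ : [set p | _] = bary a' b' c' @^-1` [set t | 0 <= t])//.
  by apply: closed_comp => [p _|]; [exact: bary_continuous|exact: closed_ge].
rewrite (_ : [set p | _] = [set p | 0 <= bary a b c p] `&` [set p | 0 <= bary b c a p]
    `&` [set p | 0 <= bary c a b p]).
  by apply: closedI => //; exact: closedI.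
by apply/seteqP; split=> p /=; [move=> []|move=> [[]]].
Qed.

(** Moving from the side in direction [b - a] makes the coordinate at [a] negative. *)
Lemma side_not_interior a b c p : det3 a b c != 0 -> bary a b c p = 0 ->
  ~ interior (triangle a b c) p.
Proof.
move=> d0 p0 /(@interior_push _ _ _ (b - a))[e e0]; rewrite triangleE// => -[].
rewrite (_ : p + e *: (b - a) = 1 *: p + e *: b + (- e) *: a); last first.
  by rewrite scale1r scalerBr scaleNr addrA.
rewrite bary_lin ?addrK// p0 bary1// bary0l mulr0 mulr0 mulr1 !add0r.
by rewrite oppr_ge0 leNgt e0.
Qed.

Lemma boundary_triangle a b c p : det3 a b c != 0 -> triangle a b c p ->
  boundary (triangle a b c) p <->
  [\/ bary a b c p = 0, bary b c a p = 0 | bary c a b p = 0].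
Proof.
move=> d0 Tp; rewrite (boundaryP _ (closed_triangle d0)); split.
  move=> [_ nint]; have := Tp; rewrite triangleE// => -[pa pb pc].
  have [?|a0] := eqVneq (bary a b c p) 0; first by constructor 1.
  have [?|b0] := eqVneq (bary b c a p) 0; first by constructor 2.
  have [?|c0] := eqVneq (bary c a b p) 0; first by constructor 3.
  by exfalso; apply: nint; apply: interior_triangle => //; rewrite lt_neqAle eq_sym ?a0 ?b0 ?c0.
move=> h; split => //; case: h => [|p0|p0]; first exact: side_not_interior.
  by rewrite -triangle_rot; apply: side_not_interior => //; rewrite det3_rot.
by rewrite -triangle_rot -triangle_rot; apply: side_not_interior => //; rewrite det3_rot det3_rot.
Qed.

(** The number [h] is at most the height over the side [b c], and the coordinate at [a] changes by
    [1] over one height. *)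
Lemma bary_far a b c p q (h : R) : det3 a b c != 0 -> h * edist b c <= `|det3 a b c| ->
  `|bary a b c p - bary a b c q| = 1 -> h <= edist p q.
Proof.
move=> d0 hbc pq; have := bary_lipschitz a b c p q; rewrite pq mul1r => le_d.
have e0 : 0 < edist b c.
  rewrite lt_neqAle edist_ge0 andbT; apply/eqP => e0.
  by move: le_d; rewrite -e0 mul0r leNgt normr_gt0 d0.
by rewrite -(ler_pM2l e0) mulrC; exact: le_trans le_d.
Qed.

Lemma path_length_ge (g : R -> R * R) : ((edist (g 1) (g 0))%:E <= path_length g)%E.
Proof.
apply: ereal_sup_ubound; exists [:: 1]; first exact: itv_partition1.
by rewrite /polygonal_length big_nat1.
Qed.

Lemma edistC p q : edist p q = edist q p.
Proof. by rewrite /edist; congr Num.sqrt; ring. Qed.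

(** Of two nonempty disjoint sets among three indices, one is a singleton; there one coordinate is
    [1] and the other [0]. *)
Lemma disjoint_supports (x1 x2 x3 y1 y2 y3 : R) :
  x1 * y1 = 0 -> x2 * y2 = 0 -> x3 * y3 = 0 ->
  x1 + x2 + x3 = 1 -> y1 + y2 + y3 = 1 ->
  [\/ `|x1 - y1| = 1, `|x2 - y2| = 1 | `|x3 - y3| = 1].
Proof.
have pos (x y : R) : x = 1 -> y = 0 -> `|x - y| = 1 by move=> -> ->; rewrite subr0 normr1.
have neg (x y : R) : x = 0 -> y = 1 -> `|x - y| = 1 by move=> -> ->; rewrite sub0r normrN normr1.
move=> /eqP; rewrite mulf_eq0 => /orP[]/eqP-> /eqP; rewrite mulf_eq0 => /orP[]/eqP-> /eqP;
  rewrite mulf_eq0 => /orP[]/eqP->; move=> sx sy.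
- exfalso; lra.
- by constructor 3; apply: pos => //; lra.
- by constructor 2; apply: pos => //; lra.
- by constructor 1; apply: neg => //; lra.
- by constructor 1; apply: pos => //; lra.
- by constructor 2; apply: neg => //; lra.
- by constructor 3; apply: neg => //; lra.
- exfalso; lra.
Qed.

(** The evader stays on the boundary, which the sensor curve touches only with its ends and at its
    first and last instant, when it is a point. So it is enough to avoid the two ends. *)
Lemma evader a b c (h : R) (f : R * R -> R * R) : det3 a b c != 0 ->
  h * edist a b <= `|det3 a b c| -> h * edist b c <= `|det3 a b c| ->
  h * edist c a <= `|det3 a b c| ->
  is_sweep (triangle a b c) f ->
  exists2 t, t \in `[0, 1] & h <= edist (f (1, t)) (f (0, t)).
Proof.
move=> d0 hab hbc hca [[fc fin _ _ [P _ fP] [Q _ fQ] fbd] sweep].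
apply: contrapT => no.
have lt_h t : t \in `[0, 1] -> edist (f (1, t)) (f (0, t)) < h.
  by move=> t01; rewrite ltNge; apply/negP => ht; apply: no; exists t.
have d0b : det3 b c a != 0 by rewrite det3_rot.
have d0c : det3 c a b != 0 by rewrite det3_rot.
have i0 : (0 : R) \in `[0, 1] by rewrite in_itv/= lexx ler01.
have i1 : (1 : R) \in `[0, 1] by rewrite in_itv/= lexx ler01.
pose pa t := bary a b c (f (0, t)) * bary a b c (f (1, t)).
pose pb t := bary b c a (f (0, t)) * bary b c a (f (1, t)).
pose pc t := bary c a b (f (0, t)) * bary c a b (f (1, t)).
pose M t := Num.max (pa t) (Num.max (pb t) (pc t)).
pose S t := (M t - pa t) + (M t - pb t) + (M t - pc t).
(* The weight of a vertex with maximal product vanishes, so [g t] lies on the opposite side. *)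
pose g t := ((M t - pa t) / S t) *: a + ((M t - pb t) / S t) *: b + ((M t - pc t) / S t) *: c.
have inT e t : e \in `[0, 1] -> t \in `[0, 1] ->
    [/\ 0 <= bary a b c (f (e, t)), 0 <= bary b c a (f (e, t)) & 0 <= bary c a b (f (e, t))].
  by move=> e01 t01; have := fin e t e01 t01; rewrite triangleE.
have pM t : [/\ pa t <= M t, pb t <= M t & pc t <= M t].
  by rewrite /M !le_max !lexx !orbT.
have Mp t : [\/ M t = pa t, M t = pb t | M t = pc t].
  rewrite /M; case: (leP (pa t) (Num.max (pb t) (pc t))) => _; last by constructor 1.
  by case: (leP (pb t) (pc t)) => _; [constructor 3|constructor 2].
(* If all three products vanish, the coordinates of the two ends have disjoint supports, and the
   ends are at least [h] apart. *)
have M0 t : t \in `[0, 1] -> 0 < M t.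
  move=> t01; rewrite ltNge; apply/negP => M0.
  have [xa xb xc] := inT _ _ i0 t01; have [ya yb yc] := inT _ _ i1 t01.
  have [pMa pMb pMc] := pM t.
  have za : pa t = 0 by apply/eqP; rewrite eq_le (le_trans pMa M0) mulr_ge0.
  have zb : pb t = 0 by apply/eqP; rewrite eq_le (le_trans pMb M0) mulr_ge0.
  have zc : pc t = 0 by apply/eqP; rewrite eq_le (le_trans pMc M0) mulr_ge0.
  have sx := bary_sum (f (0, t)) d0; have sy := bary_sum (f (1, t)) d0.
  have := lt_h t t01; rewrite ltNge => /negP; apply.
  have [H|H|H] := disjoint_supports za zb zc sx sy.
  - by rewrite edistC; exact: bary_far H.
  - by rewrite edistC; apply: (bary_far d0b _ H); rewrite det3_rot.
  - by rewrite edistC; apply: (bary_far d0c _ H); rewrite (det3_rot b c a) det3_rot.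
(* The end [f (0, t)] is on the boundary, so one product is zero and its summand is the positive
   [M t]. *)
have S0 t : t \in `[0, 1] -> 0 < S t.
  move=> t01; have Mt := M0 t t01; have [pMa pMb pMc] := pM t.
  have Tf := fin 0 t i0 t01.
  have : boundary (triangle a b c) (f (0, t)) by apply/(fbd 0 t i0 t01); constructor 1.
  move=> /(boundary_triangle d0 Tf)[] z.
  - have : pa t = 0 by rewrite /pa z mul0r.
    by rewrite /S; lra.
  - have : pb t = 0 by rewrite /pb z mul0r.
    by rewrite /S; lra.
  - have : pc t = 0 by rewrite /pc z mul0r.
    by rewrite /S; lra.
have S1 t : t \in `[0, 1] ->
    (M t - pa t) / S t + (M t - pb t) / S t + (M t - pc t) / S t = 1.
  by move=> t01; rewrite -!mulrDl divff// gt_eqF// S0.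
have gT t : t \in `[0, 1] -> triangle a b c (g t).
  move=> t01; have [pMa pMb pMc] := pM t; have St := ltW (S0 t t01).
  exists ((M t - pa t) / S t), ((M t - pb t) / S t), ((M t - pc t) / S t).
  by split => //; [rewrite divr_ge0// subr_ge0|rewrite divr_ge0// subr_ge0|
    rewrite divr_ge0// subr_ge0|exact: S1].
have cfe e : e \in `[0, 1] -> {within `[0, 1], continuous (f \o (fun t => (e, t)))}.
  move=> e01; apply: (within_continuous_comp2 fc).
    apply: continuous_subspaceT => t.
    by apply: (@cvg_pair _ _ _ (nbhs t) (nbhs e) (nbhs t) _ _ _ (fun=> e) id);
      [exact: cvg_cst|exact: cvg_id].
  by move=> _ [t t01 <-].
have cb (a' b' c' : R * R) e : e \in `[0, 1] ->
    {within `[0, 1], continuous (fun t => bary a' b' c' (f (e, t)))}.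
  move=> e01; apply: within_continuous_comp (cfe e e01) => p _; exact: bary_continuous.
have cp (a' b' c' : R * R) : {within `[0, 1], continuous (fun t =>
    bary a' b' c' (f (0, t)) * bary a' b' c' (f (1, t)))}.
  have /subspace_continuousP h0 := cb a' b' c' 0 i0.
  have /subspace_continuousP h1 := cb a' b' c' 1 i1.
  by apply/subspace_continuousP => t t01; apply: cvgM; [exact: h0|exact: h1].
have cM : {within `[0, 1], continuous M}.
  exact: max_fun_continuous (cp a b c) (max_fun_continuous (cp b c a) (cp c a b)).
have cg : {within `[0, 1], continuous g}.
  apply/subspace_continuousP => t t01.
  have /subspace_continuousP/(_ t t01) hM := cM.
  have /subspace_continuousP/(_ t t01) ha := cp a b c.
  have /subspace_continuousP/(_ t t01) hb := cp b c a.
  have /subspace_continuousP/(_ t t01) hc := cp c a b.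
  have hS : S @ within `[0, 1] (nbhs t) --> S t.
    by apply: cvgD; [apply: cvgD|]; apply: cvgB.
  have hSV : (fun t => (S t)^-1) @ within `[0, 1] (nbhs t) --> (S t)^-1.
    by apply: cvgV => //; rewrite gt_eqF// S0.
  have hwa : (fun t => (M t - pa t) / S t) @ within `[0, 1] (nbhs t) --> (M t - pa t) / S t.
    by apply: cvgM => //; apply: cvgB.
  have hwb : (fun t => (M t - pb t) / S t) @ within `[0, 1] (nbhs t) --> (M t - pb t) / S t.
    by apply: cvgM => //; apply: cvgB.
  have hwc : (fun t => (M t - pc t) / S t) @ within `[0, 1] (nbhs t) --> (M t - pc t) / S t.
    by apply: cvgM => //; apply: cvgB.
  by apply: cvgD; [apply: cvgD|]; apply: cvgZr_tmp.
have [t t01 [s s01 gt]] := sweep g cg gT.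
have [ga gb gc] : [/\ bary a b c (g t) = (M t - pa t) / S t,
    bary b c a (g t) = (M t - pb t) / S t & bary c a b (g t) = (M t - pc t) / S t].
  have St := S1 t t01; rewrite /g; split; first by rewrite baryE.
  - by rewrite -addrA addrC baryE// -St addrC addrA.
  - by rewrite addrC addrA baryE// -St -addrA addrC.
(* [g t] lies on the side opposite to a vertex whose barycentric coordinates at both
   ends of the curve are positive. *)
have away e : (e == 0) || (e == 1) -> g t <> f (e, t).
  have Mt := M0 t t01.
  move=> e01 gf; have [Me|Me|Me] := Mp t.
  - have : bary a b c (f (e, t)) = 0 by rewrite -gf ga Me subrr mul0r.
    by case/orP: e01 => /eqP -> z; move: Mt; rewrite Me /pa z ?mul0r ?mulr0 ltxx.
  - have : bary b c a (f (e, t)) = 0 by rewrite -gf gb Me subrr mul0r.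
    by case/orP: e01 => /eqP -> z; move: Mt; rewrite Me /pb z ?mul0r ?mulr0 ltxx.
  - have : bary c a b (f (e, t)) = 0 by rewrite -gf gc Me subrr mul0r.
    by case/orP: e01 => /eqP -> z; move: Mt; rewrite Me /pc z ?mul0r ?mulr0 ltxx.
have : boundary (triangle a b c) (g t).
  apply/(boundary_triangle d0 (gT _ t01)); rewrite ga gb gc.
  by have [->|->|->] := Mp t; rewrite subrr mul0r;
    [constructor 1|constructor 2|constructor 3].
rewrite gt => /(fbd s t s01 t01)[] E; move: gt; rewrite E => gt.
- by apply: (away 0) => //; rewrite eqxx.
- by apply: (away 1) => //; rewrite eqxx orbT.
- by apply: (away 0); rewrite ?eqxx// E gt !fP.
- by apply: (away 0); rewrite ?eqxx// E gt !fQ.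
Qed.

End triangle_sweep.

(** * Gauges and radial homeomorphisms *)

Section gauge.
Context {R : realType}.
Implicit Types (a b c p q v x y : R * R) (D : set (R * R)) (N : R * R -> R).

(** A Minkowski functional. Homogeneity is restricted to nonnegative factors because a triangle is
    not symmetric about its centroid. *)
Definition is_gauge N := [/\ continuous N, forall (t : R) x, 0 <= t -> N (t *: x) = t * N x &
  forall x, x != 0 -> 0 < N x].

Lemma gauge0 N : is_gauge N -> N 0 = 0.
Proof. by move=> [_ hN _]; rewrite -(scale0r 0) hN// mul0r. Qed.

Lemma gauge_ge0 N x : is_gauge N -> 0 <= N x.
Proof.
move=> gN; have [->|x0] := eqVneq x 0; first by rewrite gauge0.
by case: gN => _ _ /(_ _ x0)/ltW.
Qed.

Lemma edist_gauge : is_gauge (fun x => edist x 0).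
Proof.
split; first exact: edist_continuous.
- move=> t x t0; rewrite /edist /= /GRing.scale/= !subr0 !exprMn -mulrDr.
  by rewrite sqrtrM ?sqr_ge0// sqrtr_sqr ger0_norm.
- move=> x x0; rewrite lt_neqAle edist_ge0 andbT eq_sym; apply: contra x0 => /eqP e0.
  have := edist_fst x 0; have := edist_snd x 0; rewrite e0 /= !subr0 !normr_le0 => /eqP h2 /eqP h1.
  by rewrite [x]surjective_pairing h1 h2.
Qed.

(** The quotient [N1 / N2] is constant along rays, so its maximum on the unit circle bounds it
    everywhere. *)
Lemma gauge_le N1 N2 : is_gauge N1 -> is_gauge N2 -> exists C, forall x, N1 x <= C * N2 x.
Proof.
move=> gN1 gN2; have [c1 h1 p1] := gN1; have [c2 h2 p2] := gN2; have [cE hE pE] := edist_gauge.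
pose S := [set x : R * R | edist x 0 = 1].
have S_neq0 x : S x -> x != 0.
  move=> Sx; apply/eqP => x0; move: Sx; rewrite /S /= x0 (gauge0 edist_gauge) => /eqP.
  by rewrite eq_sym oner_eq0.
have cS : compact S.
  apply: (@subclosed_compact _ _ [set x : R * R | edist x 0 <= 1]); last by move=> x /= ->.
    rewrite (_ : S = (fun x : R * R => edist x 0) @^-1` [set 1])//.
    by apply: closed_comp => [x _|]; [exact: cE|exact: closed_eq].
  exact: compact_disc.
have S0 : S !=set0.
  by exists (1, 0); rewrite /S /= /edist /= !subr0 expr1n expr0n addr0 sqrtr1.
have cr : {within S, continuous (fun x => N1 x / N2 x)}.
  apply/subspace_continuousP => x Sx; apply: cvgM.
    by apply: cvg_within_filter; exact: c1.
  apply: cvgV; first by rewrite gt_eqF// p2// S_neq0.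
  by apply: cvg_within_filter; exact: c2.
have [p _ hp] := compact_EVT_max S0 cS cr.
exists (N1 p / N2 p) => x; have [->|x0] := eqVneq x 0; first by rewrite !gauge0// mulr0.
have e0 := pE _ x0.
pose u := (edist x 0)^-1 *: x.
have xE : x = edist x 0 *: u by rewrite /u scalerA divff ?gt_eqF// scale1r.
have Su : u \in S by rewrite inE /S /= /u hE ?invr_ge0 ?(ltW e0)// mulVf ?gt_eqF.
have u2 : 0 < N2 u by apply: p2; apply: S_neq0; rewrite -inE.
have := hp u Su; rewrite ler_pdivrMr// => h.
by rewrite xE h1 ?(ltW e0)// h2 ?(ltW e0)// mulrCA ler_pM2l.
Qed.

(** Rescales each ray so that level sets of [N1] go to level sets of [N2]. At the origin the value
    is [0], whatever the quotient. *)
Definition radial N1 N2 x : R * R := (N1 x / N2 x) *: x.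

Lemma radial_continuous N1 N2 : is_gauge N1 -> is_gauge N2 -> continuous (radial N1 N2).
Proof.
move=> gN1 gN2 x; have [c1 h1 p1] := gN1; have [c2 h2 p2] := gN2.
have [x0|x0] := eqVneq x 0; last first.
  apply: (@cvgZ _ _ _ _ _ (fun x => N1 x / N2 x) id _ _); last exact: cvg_id.
  apply: cvgM; first exact: c1.
  by apply: cvgV; [rewrite gt_eqF// p2|exact: c2].
have [C hC] := gauge_le gN1 gN2.
(* At the origin continuity follows from the boundedness of the quotient. *)
have ratio y : `|N1 y / N2 y| <= `|C|.
  have [->|y0] := eqVneq y 0; first by rewrite gauge0// mul0r normr0.
  rewrite ger0_norm ?divr_ge0 ?gauge_ge0// ler_pdivrMr ?p2//.
  by apply: (le_trans (hC y)); rewrite ler_wpM2r ?gauge_ge0// ler_norm.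
have C0 : 0 < `|C| + 1 by rewrite ltr_wpDl.
move=> A /nbhs_planeP[e e0 eA]; apply/nbhs_planeP; exists (e / (`|C| + 1)); first by rewrite divr_gt0.
have bound (y : R * R) (z : R) : `|z - 0| < e / (`|C| + 1) -> `|N1 y / N2 y * z - 0| < e.
  rewrite !subr0 ltr_pdivlMr// normrM => h.
  apply: le_lt_trans h; rewrite mulrC ler_wpM2l//.
  by apply: (le_trans (ratio y)); rewrite lerDl.
rewrite x0 => y y1 y2; apply: eA; rewrite /radial x0 scaler0 /=; exact: bound.
Qed.

Lemma gauge_radial N1 N2 x : is_gauge N1 -> is_gauge N2 -> N2 (radial N1 N2 x) = N1 x.
Proof.
move=> gN1 gN2; have [_ h2 p2] := gN2.
rewrite /radial h2 ?divr_ge0 ?gauge_ge0//.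
have [->|x0] := eqVneq x 0; first by rewrite !gauge0// mulr0.
by rewrite divfK// gt_eqF// p2.
Qed.

Lemma radialK N1 N2 : is_gauge N1 -> is_gauge N2 -> cancel (radial N1 N2) (radial N2 N1).
Proof.
move=> gN1 gN2 x; rewrite {1}/radial gauge_radial//.
have [->|x0] := eqVneq x 0; first by rewrite /radial !scaler0.
have [_ h1 p1] := gN1; have [_ h2 p2] := gN2.
rewrite /radial h1 ?divr_ge0 ?gauge_ge0// scalerA.
rewrite (_ : _ * _ = 1) ?scale1r//; field.
by rewrite !gt_eqF ?p1 ?p2.
Qed.

Lemma gauge_jordan N (o : R * R) : is_gauge N -> jordan_domain [set x | N (x - o) <= 1].
Proof.
move=> gN; have gE := edist_gauge.
exists (fun x => radial (fun x => edist x 0) N x + o),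
  (fun y => radial N (fun x => edist x 0) (y - o)).
split.
- apply: continuous_subspaceT => x; apply: cvgD; last exact: cvg_cst.
  exact: radial_continuous.
- apply: continuous_subspaceT => x.
  apply: (@continuous_comp _ _ _ (fun y => y - o) (radial N (fun x => edist x 0))).
    by apply: cvgB; [exact: cvg_id|exact: cvg_cst].
  exact: radial_continuous.
- by move=> _ [x /= x1 <-]; rewrite /= addrK gauge_radial.
- by move=> _ [x /= x1 <-]; rewrite /= (gauge_radial _ gN gE).
- split => x _; first by rewrite addrK radialK.
  by rewrite radialK// subrK.
Qed.

Lemma jordan_triangle a b c : det3 a b c != 0 -> jordan_domain (triangle a b c).
Proof.
move=> d0; have d0b : det3 b c a != 0 by rewrite det3_rot.
have d0c : det3 c a b != 0 by rewrite det3_rot.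
have s3 : 3^-1 + 3^-1 + 3^-1 = 1 :> R by field.
have [ o [oE oa ob oc]] : exists o, [/\ o = 3^-1 *: a + 3^-1 *: b + 3^-1 *: c,
    bary a b c o = 3^-1, bary b c a o = 3^-1 & bary c a b o = 3^-1].
  exists (3^-1 *: a + 3^-1 *: b + 3^-1 *: c).
  by split => //; rewrite bary_lin// bary0l bary0r bary1// mulr1 !mulr0 ?add0r ?addr0.
(* At the centroid [o] each coordinate is [1 / 3], so [1 - 3 bary] is linear in the displacement
   [v], and it is at most [1] exactly when the coordinate is nonnegative. *)
have lina (a' b' c' : R * R) : bary a' b' c' o = 3^-1 ->
    exists n, forall v, 1 - 3 * bary a' b' c' (o + v) = lin n v.
  have [x [y [z E]]] := bary_affine a' b' c'; rewrite E => h.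
  exists (- 3 * x, - 3 * y) => v; rewrite E /lin /=.
  have -> : z = 3^-1 - (x * o.1 + y * o.2) by rewrite -h; ring.
  by field.
have [na Ea] := lina _ _ _ oa; have [nb Eb] := lina _ _ _ ob; have [nc Ec] := lina _ _ _ oc.
pose N v := Num.max (lin na v) (Num.max (lin nb v) (lin nc v)).
have gN : is_gauge N.
  split.
  - exact: max_fun_continuous (@lin_continuous _ na)
      (max_fun_continuous (@lin_continuous _ nb) (@lin_continuous _ nc)).
  - by move=> t v t0; rewrite /N !linZ !maxr_pMr.
  (* If the gauge is not positive, all coordinates of [o + v] are at least [1 / 3]; as they sum to
     [1], the point is the centroid. *)
  - move=> v; apply: contraNT; rewrite -leNgt /N !ge_max -Ea -Eb -Ec => /and3P[ha hb hc].
    have s := bary_sum (o + v) d0; apply/eqP.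
    have := bary_comb (o + v) d0.
    have -> : bary a b c (o + v) = 3^-1 by lra.
    have -> : bary b c a (o + v) = 3^-1 by lra.
    have -> : bary c a b (o + v) = 3^-1 by lra.
    by rewrite -oE -[RHS]addr0 => /addrI.
rewrite (_ : triangle a b c = [set x | N (x - o) <= 1]); first exact: gauge_jordan.
rewrite triangleE//; apply/funext => x; apply/propext.
rewrite /= /N !ge_max -Ea -Eb -Ec (_ : o + (x - o) = x); last by rewrite addrC subrK.
split=> [[h1 h2 h3]|/and3P[h1 h2 h3]]; first by apply/and3P; split; lra.
by split; lra.
Qed.

Lemma convex_triangle a b c : det3 a b c != 0 -> @convex_set R (R * R)%type (triangle a b c).
Proof.
move=> d0 p q l; rewrite !inE triangleE// => -[pa pb pc] [qa qb qc].
have l0 : 0 <= l%:num by []; have l1 : 0 <= 1 - l%:num by rewrite subr_ge0.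
have E (a' b' c' : R * R) : bary a' b' c' (l%:num *: (p : R * R) + (1 - l%:num) *: (q : R * R)) =
   l%:num * bary a' b' c' p + (1 - l%:num) * bary a' b' c' q.
  have [x [y [z H]]] := bary_affine a' b' c'; rewrite !H /= /GRing.scale/=; ring.
rewrite /= /conv /=.
by split; rewrite E addr_ge0// mulr_ge0.
Qed.

End gauge.

(** * Sweeping cost, area and the equality case *)

Section conclusion.
Context {R : realType}.
Implicit Types (a b c p : R * R) (D : set (R * R)).

Lemma sensor_length_ge0 (f : R * R -> R * R) : (0 <= sensor_length f)%E.
Proof.
apply: (@le_trans _ _ (path_length (fun s => f (s, 0)))).
  by apply: le_trans (path_length_ge _); rewrite lee_fin edist_ge0.
by apply: ereal_sup_ubound; exists 0 => //; rewrite /= in_itv/= lexx ler01.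
Qed.

Lemma convex_jordan_not_line D (x y z : R) : convex_jordan_domain D -> (x != 0) || (y != 0) ->
  ~ (forall p, D p -> x * p.1 + y * p.2 = z).
Proof. by move=> [jD _]; exact: jordan_not_line. Qed.

Lemma sweeping_cost_width D (x y m M : R) : convex_jordan_domain D -> (x != 0) || (y != 0) ->
  (forall p, D p -> m <= x * p.1 + y * p.2 <= M) ->
  (sweeping_cost D <= ((M - m) / Num.sqrt (x ^+ 2 + y ^+ 2))%:E)%E.
Proof.
move=> jD xy0 strip; have [/jordan_compact cD vD] := jD.
apply: (@sweeping_cost_strip R D (x, y)) => //.
- by apply: interior_nonempty => // ? ? ?; exact: convex_jordan_not_line.
- by apply: contraTneq xy0 => -[-> ->]; rewrite eqxx.
Qed.

Lemma sweeping_cost_fin D : convex_jordan_domain D ->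
  exists2 w : R, 0 <= w & sweeping_cost D = w%:E.
Proof.
move=> jD; have [/jordan_compact cD vD] := jD.
have [p0 Dp0] : D !=set0.
  have [p ip] : exists p, interior D p.
    by apply: interior_nonempty => // ? ? ?; exact: convex_jordan_not_line.
  by exists p; exact: interior_subset ip.
have c1 : {within D, continuous (fst : R * R -> R)}.
  by apply: continuous_subspaceT; exact: continuous_fst2.
have [p _ pmax] := compact_EVT_max (ex_intro _ p0 Dp0) cD c1.
have [q _ qmin] := compact_EVT_min (ex_intro _ p0 Dp0) cD c1.
have le : (sweeping_cost D <= ((p.1 - q.1) / Num.sqrt (1 ^+ 2 + 0 ^+ 2))%:E)%E.
  apply: sweeping_cost_width => //; first by rewrite oner_neq0.
  by move=> r Dr; rewrite mul1r mul0r addr0 qmin ?inE// pmax ?inE.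
have ge : (0 <= sweeping_cost D)%E.
  by apply: le_ereal_inf_tmp => _ [f _ <-]; exact: sensor_length_ge0.
by case: (sweeping_cost D) le ge => // w _ w0; exists w.
Qed.

Lemma convex_jordan_area D : convex_jordan_domain D ->
  (sweeping_cost D ^+ 2 / (Num.sqrt 3)%:E <= area D)%E.
Proof.
move=> jD; have [/jordan_compact cD vD] := jD.
have [w w0 wE] := sweeping_cost_fin jD; rewrite wE -EFin_expe inver gt_eqF ?sqrtr_gt0// -EFinM.
apply: isominwidth => //; first by move=> ? ? ?; exact: convex_jordan_not_line.
move=> x y m M xy0 strip; have := sweeping_cost_width jD xy0 strip.
rewrite wE lee_fin ler_pdivlMr// sqrtr_gt0 lt_neqAle addr_ge0 ?sqr_ge0// andbT eq_sym.
by rewrite paddr_eq0 ?sqr_ge0// !sqrf_eq0 negb_and.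
Qed.

(** All three heights equal [h]. The strip between the side [b c] and the vertex [a] gives the upper
    bound; the evader gives the lower one, as a path is at least as long as the distance of its
    ends. *)
Lemma sweeping_cost_triangle a b c (h : R) : det3 a b c != 0 ->
  h * edist a b = `|det3 a b c| -> h * edist b c = `|det3 a b c| ->
  h * edist c a = `|det3 a b c| -> sweeping_cost (triangle a b c) = h%:E.
Proof.
move=> d0 hab hbc hca; apply/eqP; rewrite eq_le; apply/andP; split; last first.
  apply: le_ereal_inf_tmp => _ [f sf <-].
  have [||| t t01 ht] := evader d0 _ _ _ sf (h := h); rewrite ?hab ?hbc ?hca//.
  apply: (@le_trans _ _ (path_length (fun s => f (s, t)))); last first.
    by apply: ereal_sup_ubound; exists t.
  by apply: le_trans (path_length_ge _); rewrite lee_fin.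
have jT : convex_jordan_domain (triangle a b c).
  by split; [exact: jordan_triangle|exact: convex_triangle].
have e0 : 0 < edist b c.
  rewrite lt_neqAle edist_ge0 andbT; apply/eqP => e0.
  by move: hbc; rewrite -e0 mulr0 => /esym/eqP; rewrite normr_eq0 (negPf d0).
pose k := b.1 * c.2 - b.2 * c.1.
have eE : edist b c = Num.sqrt ((b.2 - c.2) ^+ 2 + (c.1 - b.1) ^+ 2).
  by rewrite /edist; congr Num.sqrt; ring.
(* Maximum and minimum with [0] treat both orientations of the triangle at once. *)
have -> : h = ((Num.max 0 (det3 a b c) - k) - (Num.min 0 (det3 a b c) - k)) / edist b c.
  apply: (canRL (mulfK (lt0r_neq0 e0))); rewrite hbc.
  by case: (ltgtP 0 (det3 a b c)) => h0;
    [rewrite gtr0_norm//|rewrite ltr0_norm//|rewrite -h0 normr0]; ring.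
rewrite eE; apply: sweeping_cost_width => //.
  rewrite -negb_and; apply/negP => /andP[/eqP h1 /eqP h2].
  by move: e0; rewrite eE h1 h2 expr0n/= addr0 sqrtr0 ltxx.
move=> p; rewrite triangleE// => -[pa pb pc].
have s := bary_sum p d0.
have -> : (b.2 - c.2) * p.1 + (c.1 - b.1) * p.2 = bary a b c p * det3 a b c - k.
  by rewrite divfK// /det3 /k; ring.
rewrite !lerD2r ge_min le_max; set d := det3 a b c.
have [d_ge0|d_lt0] := leP 0 d; apply/andP; split; apply/orP.
- by left; rewrite mulr_ge0.
- by right; rewrite ler_piMl//; lra.
- by right; rewrite ler_nMl//; lra.
- by left; rewrite mulr_ge0_le0// ltW.
Qed.

Lemma equilateral_det3 a b c : edist a b = edist b c -> edist b c = edist c a ->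
  `|det3 a b c| = Num.sqrt 3 / 2 * edist a b ^+ 2.
Proof.
move=> h1 h2; apply/eqP; rewrite -(@eqrXn2 _ 2)//; last first.
  by rewrite mulr_ge0 ?sqr_ge0// divr_ge0// sqrtr_ge0.
rewrite real_normK ?num_real// !exprMn exprVn sqr_sqrtr//.
have e1 : edist a b ^+ 2 = edist b c ^+ 2 by rewrite h1.
have e2 : edist a b ^+ 2 = edist c a ^+ 2 by rewrite h1 h2.
(* Heron's formula in terms of the squared sides. *)
have : det3 a b c ^+ 2 = (2 * (edist a b ^+ 2 * edist b c ^+ 2 +
    edist b c ^+ 2 * edist c a ^+ 2 + edist c a ^+ 2 * edist a b ^+ 2) -
    (edist a b ^+ 2 * edist a b ^+ 2 + edist b c ^+ 2 * edist b c ^+ 2 +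
     edist c a ^+ 2 * edist c a ^+ 2)) / 4.
  by rewrite !edist_sqr /det3; field.
rewrite -e1 -e2 => ->; apply/eqP; by field.
Qed.

Theorem equilateral_triangle_sweep (T : set (R * R)) : equilateral_triangle T ->
  convex_jordan_domain T /\ area T = (sweeping_cost T ^+ 2 / (Num.sqrt 3)%:E)%E.
Proof.
move=> [a [b [c [e0 eab ebc ->]]]].
have s3 : Num.sqrt 3 ^+ 2 = 3 :> R by rewrite sqr_sqrtr.
have s30 : 0 < Num.sqrt 3 :> R by rewrite sqrtr_gt0.
have dE := equilateral_det3 eab ebc.
have d0 : det3 a b c != 0 by rewrite -normr_gt0 dE mulr_gt0 ?divr_gt0// exprn_gt0.
split; first by split; [exact: jordan_triangle|exact: convex_triangle].
rewrite area_triangle//.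
rewrite (@sweeping_cost_triangle _ _ _ (Num.sqrt 3 / 2 * edist a b)) -?ebc -?eab ?dE//; last 3 first.
- by rewrite expr2 mulrA.
- by rewrite expr2 mulrA.
- by rewrite expr2 mulrA.
rewrite -EFin_expe inver gt_eqF// -EFinM; congr EFin.
apply: (canRL (mulfK (lt0r_neq0 s30))).
rewrite !exprMn s3 exprVn; transitivity (Num.sqrt 3 ^+ 2 * edist a b ^+ 2 / 4); first by field.
by rewrite s3; field.
Qed.

End conclusion.

Local Open Scope ereal_scope.

Theorem corollary9p1 (R : realType) :
  (forall D : set (R * R), convex_jordan_domain D ->
     sweeping_cost D ^+ 2 / (Num.sqrt 3)%:E <= area D) /\
  (forall T : set (R * R), equilateral_triangle T ->
     [/\ convex_jordan_domain T,
         area T = sweeping_cost T ^+ 2 / (Num.sqrt 3)%:E &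
         forall D : set (R * R), convex_jordan_domain D ->
           area D = area T -> sweeping_cost D <= sweeping_cost T]).
Proof.
split; first by move=> D; exact: convex_jordan_area.
move=> T eT; have [jT aT] := equilateral_triangle_sweep eT; split => // D jD aD.
(* The inequality for [D] and the equality for [T] compare the squares of two nonnegative real
   costs. *)
have := convex_jordan_area jD; rewrite aD aT.
have [w w0 ->] := sweeping_cost_fin jD; have [h h0 ->] := sweeping_cost_fin jT.
have s30 : (0 < Num.sqrt 3 :> R)%R by rewrite sqrtr_gt0.
rewrite -!EFin_expe inver gt_eqF// -!EFinM !lee_fin ler_pM2r ?invr_gt0//.
by rewrite ler_pXn2r.
Qed.
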